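(* Let $\alpha\in(0,1)$, $T>0$, $\mathcal{A}\in\mathbb{C}^{d\times d}$, $\vartheta\in\mathcal{C}[0,T]$, $x_0\in\mathbb{C}^d$, and let $\mathfrak{U}_1,\mathfrak{U}_2,\ldots$ be independent random variables with distribution $\mathrm{Beta}(2-\alpha,\alpha)$. Then the solution on $[0,T]$ of $x(t)=x_0+{}^LJ^\alpha(\mathcal{A}x+\vartheta)(t)$ is $$x(t)=\mathcal{E}_\alpha(\mathcal{A}t)x_0+\sum_{j=0}^\infty\mathcal{A}^jt^{j+1}\,\mathbb{E}_{\mathfrak{U}_{j+1}}\Big[\mathfrak{U}_{j+1}^{j}\,\mathbb{E}_{\mathfrak{U}_j}\Big[\mathfrak{U}_j^{j-1}\cdots\mathbb{E}_{\mathfrak{U}_2}\Big[\mathfrak{U}_2\,\mathbb{E}_{\mathfrak{U}_1}\big[\vartheta(t\mathfrak{U}_1\cdots\mathfrak{U}_{j+1})\big]\Big]\cdots\Big]\Big].$$ If $x$ and $\vartheta$ are absolutely continuous on $[0,T]$, then $x$ solves ${}^LD^\alpha x=\mathcal{A}x+\vartheta$ almost everywhere on $[0,T]$; if $x$ and $\vartheta$ are given by absolutely convergent power series on $[0,T]$, it holds for every $t\in[0,T]$.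
   Context: $\mathbb{E}_{\mathfrak{U}}[g(\mathfrak{U},\mathfrak{V})]$ denotes the expectation with respect to $\mathfrak{U}$ only, with the other variables held fixed (conditional expectation given them). $\mathcal{E}_\alpha(s)=\sum_{n=0}^\infty\frac{s^n}{\Gamma(2-\alpha)^n\prod_{j=1}^n\frac{\Gamma(j+1)}{\Gamma(j+1-\alpha)}}$ (matrix arguments allowed). ${}^LJ^\alpha y(t)=\frac{1}{\Gamma(\alpha)\Gamma(2-\alpha)}\int_0^t (t-s)^{\alpha-1}s^{1-\alpha}y(s)\,ds$, equivalently $t\,\mathbb{E}[y(t\mathfrak{U})]$ with $\mathfrak{U}\sim\mathrm{Beta}(2-\alpha,\alpha)$. Caputo derivative ${}^CD^\alpha x(t)=\frac{1}{\Gamma(1-\alpha)}\int_0^t (t-\tau)^{-\alpha}x'(\tau)d\tau$; ${}^LD^\alpha x(t)=\frac{\Gamma(2-\alpha)}{t^{1-\alpha}}{}^CD^\alpha x(t)$, extended to $t=0$ by continuity for $C^2$ functions. *)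

(* Defs.v *)
From HB Require Import structures.
From mathcomp Require Import all_boot all_order all_algebra.
From mathcomp Require Import all_classical all_reals all_analysis.
From mathcomp Require Import complex.
Import Order.TTheory GRing.Theory Num.Theory.
Import numFieldNormedType.Exports.

Set Implicit Arguments.
Unset Strict Implicit.
Unset Printing Implicit Defensive.

Local Open Scope ring_scope.
Local Open Scope classical_set_scope.

HB.instance Definition _ (R : realType) := PseudoPointedMetric.copy R[i] (R[i])^o.
HB.instance Definition _ (R : realType) := NormedModule.copy R[i] (R[i])^o.

Section FracDefs.
Variable R : realType.
Local Notation C := R[i].
Local Notation mu := (@lebesgue_measure R).

Definition Gamma (x : R) : R :=
  \int[mu]_(t in `]0, +oo[) (t `^ (x - 1) * expR (- t)).

Definition cint (D : set R) (f : R -> C) : C :=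
  ((\int[mu]_(s in D) complex.Re (f s)) +i* (\int[mu]_(s in D) complex.Im (f s)))%C.

Variable d : nat.

Definition vint (D : set R) (f : R -> 'cV[C]_d) : 'cV[C]_d :=
  \col_(i < d) cint D (fun s => f s i ord0).

Definition vnorm (v : 'cV[C]_d) : R := \sum_(i < d) complex.Re `|v i ord0|.

Definition vderiv (f : R -> 'cV[C]_d) (t : R) : 'cV[C]_d :=
  \col_(i < d) (((fun s => complex.Re (f s i ord0))^`() t)
                 +i* ((fun s => complex.Im (f s i ord0))^`() t))%C.

Definition abs_cont_on (a b : R) (f : R -> 'cV[C]_d) : Prop :=
  forall e : R, 0 < e -> exists2 del : R, 0 < del &
    forall (n : nat) (s t : 'I_n -> R),
      (forall k, a <= s k /\ s k <= t k /\ t k <= b) ->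
      (forall k l, k != l -> t k <= s l \/ t l <= s k) ->
      \sum_(k < n) (t k - s k) < del ->
      \sum_(k < n) vnorm (f (t k) - f (s k)) < e.

Definition abs_pseries_on (T : R) (f : R -> 'cV[C]_d) : Prop :=
  exists c : nat -> 'cV[C]_d,
    cvgn (series (fun k => vnorm (c k) * T ^+ k)) /\
    forall t, 0 <= t <= T ->
      series (fun k => (t ^+ k)%:C%C *: c k) @ \oo --> f t.

Definition LJ (alpha : R) (y : R -> 'cV[C]_d) (t : R) : 'cV[C]_d :=
  ((Gamma alpha * Gamma (2 - alpha))^-1)%:C%C *:
    vint `[0, t] (fun s => ((t - s) `^ (alpha - 1) * s `^ (1 - alpha))%:C%C *: y s).

Definition CD (alpha : R) (x : R -> 'cV[C]_d) (t : R) : 'cV[C]_d :=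
  ((Gamma (1 - alpha))^-1)%:C%C *:
    vint `[0, t] (fun tau => ((t - tau) `^ (- alpha))%:C%C *: vderiv x tau).

Definition LD (alpha : R) (x : R -> 'cV[C]_d) (t : R) : 'cV[C]_d :=
  (Gamma (2 - alpha) / t `^ (1 - alpha))%:C%C *: CD alpha x t.

Definition beta_const (alpha : R) : R :=
  \int[mu]_(u in `[0, 1]) (u `^ (1 - alpha) * (1 - u) `^ (alpha - 1)).

Definition betaE (alpha : R) (g : R -> 'cV[C]_d) : 'cV[C]_d :=
  ((beta_const alpha)^-1)%:C%C *:
    vint `[0, 1] (fun u => (u `^ (1 - alpha) * (1 - u) `^ (alpha - 1))%:C%C *: g u).

(* nested expectations:
   nestE 0 s = theta(s),
   nestE (k+1) s = E_{U_{k+1}}[ U_{k+1}^k nestE k (s U_{k+1}) ], so that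
   nestE (j+1) t = E_{U_{j+1}}[U_{j+1}^j E_{U_j}[ ... E_{U_2}[U_2 E_{U_1}[theta(t U_1...U_{j+1})]]]] *)
Fixpoint nestE (alpha : R) (theta : R -> 'cV[C]_d) (k : nat) : R -> 'cV[C]_d :=
  match k with
  | 0 => theta
  | k'.+1 => fun s => betaE alpha (fun u => (u ^+ k')%:C%C *: nestE alpha theta k' (s * u))
  end.

Definition ml_coef (alpha : R) (n : nat) : R :=
  ((Gamma (2 - alpha)) ^+ n *
   \prod_(1 <= j < n.+1) (Gamma (j%:R + 1) / Gamma (j%:R + 1 - alpha)))^-1.

Definition ml_partial (alpha : R) (M : 'M[C]_d) (n : nat) : 'M[C]_d :=
  \sum_(k < n) (ml_coef alpha k)%:C%C *: M ^+ k.

Definition ml_mx (alpha : R) (M : 'M[C]_d) : 'M[C]_d := limn (ml_partial alpha M).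

Definition sol_partial (alpha : R) (A : 'M[C]_d) (theta : R -> 'cV[C]_d) (t : R)
    (n : nat) : 'cV[C]_d :=
  \sum_(j < n) (A ^+ j *m ((t ^+ j.+1)%:C%C *: nestE alpha theta j.+1 t)).

Definition sol_formula (alpha : R) (A : 'M[C]_d) (x0 : 'cV[C]_d)
    (theta : R -> 'cV[C]_d) (t : R) : 'cV[C]_d :=
  ml_mx alpha (t%:C%C *: A) *m x0 + limn (sol_partial alpha A theta t).

End FracDefs.

(* Main.v *)
Require Import Defs.
From HB Require Import structures.
From mathcomp Require Import all_boot all_order all_algebra.
From mathcomp Require Import all_classical all_reals all_analysis.
From mathcomp Require Import complex.
From mathcomp Require Import measurable_realfun ring lra.
Import Order.TTheory GRing.Theory Num.Theory.
Import numFieldNormedType.Exports.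
Local Open Scope ring_scope.
Local Open Scope classical_set_scope.

(** The operator [LJ] sends a function bounded by [M * s ^ k] to one bounded by
    [M * m k * t ^ k.+1], where [m k] is the [k]-th moment of Beta(2 - alpha, alpha)
    and [ml_coef] is the sequence of partial products of [m].  Since [m k] tends to
    0, the Picard series, with terms [A ^ k J^k x0 + A ^ k J^(k+1) theta], converges
    uniformly on [[0, T]]; its limit is the only solution of the integral equation,
    and [t ^ k * nestE k t = J^k theta] identifies it with the formula.

    Write [I^a h] for the convolution of [h] with [u ^ (a - 1)].  Fubini and the
    Beta-Gamma identity give [I^a I^b = B(a, b) I^(a+b)].  If [x] is absolutely
    continuous, its variation is the cumulative function of a measure absolutely
    continuous with respect to Lebesgue measure, so Radon-Nikodym gives [x] an
    integrable density [g] equal to its derivative almost everywhere; applying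
    [I^(1-alpha)] to both sides of the integral equation yields an identity between
    primitives of [I^(1-alpha) g] and of a multiple of [A x + theta], which is then
    differentiated.  For power series the density is an explicit series, on which
    [I^(1-alpha)] acts termwise by dominated convergence. *)

Set Implicit Arguments.
Unset Strict Implicit.
Unset Printing Implicit Defensive.

(** All analysis is done on real functions: a vector of [C^d] is replaced by its 2d real
    coordinates, on which integrals, derivatives and limits act one by one, and [A] by a real
    matrix. Functions given on [[0, T]] are extended to the line, continuous ones by clamping the
    argument and integrands by 0, so that fractional integrals become convolutions to which scaling
    and Fubini apply.

    The obstacle in the differential equation is that the derivative inside the Caputo integral is
    pointwise and controlled only off a null set. It is therefore replaced by a density [G] with
    [x t - x 0] equal to the integral of [G] over [[0, t]]; this changes the Caputo integral at no
    [t]. For a merely integrable [G], however, [I^(1-alpha) G] is reached only through its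
    primitive, which determines it up to a null set: this is where [almost everywhere] enters. An
    equality at every [t] requires evaluating [I^(1-alpha) G] itself, which is possible when [G] is
    explicit. *)

(** * Affine change of variables for the Lebesgue integral *)

Section Affine.
Variable R : realType.
Local Notation mu := (@lebesgue_measure R).

Lemma measurable_affine (a b : R) : measurable_fun [set: R] (fun x : R => a * x + b).
Proof. by apply: measurable_funD => //; apply: measurable_funM. Qed.

(** [|a|] times the pushforward of [mu] under [x |-> a * x + b] agrees with [mu] on half-open
    intervals, hence is [mu] by uniqueness of the Lebesgue measure. *)
Lemma integral_affine (a b : R) (f : R -> \bar R) : a != 0 ->
  measurable_fun [set: R] f -> (forall x, (0 <= f x)%E) ->
  (\int[mu]_x f x = `|a|%:E * \int[mu]_x f (a * x + b)%R)%E.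
Proof.
move=> a0 mf f0; set phi := fun x : R => a * x + b.
have mphi : measurable_fun [set: R] phi by exact: measurable_affine.
pose na := NngNum (normr_ge0 a).
pose nu' : {measure set (measurableTypeR R) -> \bar R} :=
  mscale na (pushforward mu (phi : measurableTypeR R -> measurableTypeR R)).
pose nu := nu' mphi.
transitivity (\int[nu]_x f x)%E.
  apply: eq_measure_integral => /= A mA _.
  apply: (@lebesgue_measure_unique R nu) => // X /ocitvP[->|[[c d] /= cd ->]].
    by rewrite !measure0.
  rewrite /nu /nu' /mscale /= /pushforward lebesgue_measure_itv/= lte_fin cd.
  (* For [a < 0] the preimage of []c, d]] is closed on the left and open on the right, which does
     not affect its length. *)
  have [a_lt0|a_gt0|/eqP] := ltrgtP a 0; last by rewrite (negbTE a0).
    rewrite [X in mu X](_ : _ = `[(d - b) / a, (c - b) / a[%classic); last first.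
      apply/seteqP; split=> x /=; rewrite !in_itv/= /phi.
        by rewrite ler_ndivrMr// ltr_ndivlMr// ![x * a]mulrC; lra.
      by rewrite ler_ndivrMr// ltr_ndivlMr// ![x * a]mulrC; lra.
    rewrite lebesgue_measure_itv/= lte_fin ltr_ndivrMr// divfK// ltrD2r cd.
    rewrite -!EFinB -EFinM ltr0_norm//; congr EFin; field.
    by rewrite a0.
  rewrite [X in mu X](_ : _ = `](c - b) / a, (d - b) / a]%classic); last first.
    apply/seteqP; split=> x /=; rewrite !in_itv/= /phi.
      by rewrite ltr_pdivrMr// ler_pdivlMr// ![x * a]mulrC; lra.
    by rewrite ltr_pdivrMr// ler_pdivlMr// ![x * a]mulrC; lra.
  rewrite lebesgue_measure_itv/= lte_fin ltr_pdivrMr// divfK// ltrD2r cd.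
  rewrite -!EFinB -EFinM gtr0_norm//; congr EFin; field.
  by rewrite a0.
rewrite /nu /nu' ge0_integral_mscale//; congr (_ * _)%E.
by rewrite ge0_integral_pushforward.
Qed.

Lemma integral_affine_integrable (a b : R) (f : R -> R) : a != 0 ->
  mu.-integrable [set: R] (EFin \o f) ->
  mu.-integrable [set: R] (fun x => (f (a * x + b))%:E) /\
  \int[mu]_x f x = `|a| * \int[mu]_x f (a * x + b).
Proof.
move=> a0 intf.
have /measurable_EFinP mf := measurable_int mu intf.
have mfa : measurable_fun [set: R] (fun x => f (a * x + b)).
  by apply: (measurableT_comp mf); exact: measurable_affine.
have aE : (0 < `|a|%:E)%E by rewrite lte_fin normr_gt0.
have intfa : mu.-integrable [set: R] (fun x => (f (a * x + b))%:E).
  apply/integrableP; split; first exact/measurable_EFinP.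
  move/integrableP : intf => [_].
  rewrite (integral_affine b a0)//=; last first.
    by apply/measurable_EFinP; exact: measurableT_comp.
  by apply: contraTT; rewrite -!leNgt !leye_eq => /eqP ->; rewrite gt0_muley.
split=> //.
rewrite /Rintegral [in LHS]integralE [in RHS]integralE.
rewrite (integral_affine b a0 (f:=((fun x => (f x)%:E)^\+)%E))//; last first.
  by apply: measurable_funepos; exact/measurable_EFinP.
rewrite (integral_affine b a0 (f:=((fun x => (f x)%:E)^\-)%E))//; last first.
  by apply: measurable_funeneg; exact/measurable_EFinP.
have := integral_fune_fin_num measurableT (integrable_funepos measurableT intfa).
have := integral_fune_fin_num measurableT (integrable_funeneg measurableT intfa).
have -> : (fun x => ((fun y => (f y)%:E)^\+)%E (a * x + b)) =
  ((fun x => (f (a * x + b))%:E)^\+)%E by apply/funext => x; rewrite !funeposE.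
have -> : (fun x => ((fun y => (f y)%:E)^\-)%E (a * x + b)) =
  ((fun x => (f (a * x + b))%:E)^\-)%E by apply/funext => x; rewrite !funenegE.
move=> /fineK <- /fineK <-.
by rewrite -!EFinM -!EFinB /= -mulrBr.
Qed.

End Affine.

(** * Power kernels, Gamma and Beta integrals in the extended reals *)

Section Kernel.
Variable R : realType.
Local Notation mu := (@lebesgue_measure R).
Implicit Types a b u x : R.

(* The Riemann-Liouville kernel extended by 0 to the negative half-line, so that
   fractional integrals become convolutions over the whole line. *)
Definition powk a u : R := if 0 < u then u `^ (a - 1) else 0.

Lemma powk_ge0 a u : 0 <= powk a u.
Proof. by rewrite /powk; case: ifP => // _; exact: powR_ge0. Qed.

Lemma powk_gt0 a u : 0 < u -> 0 < powk a u.
Proof. by move=> u0; rewrite /powk u0 powR_gt0. Qed.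

Lemma powk_le0 a u : u <= 0 -> powk a u = 0.
Proof. by rewrite /powk ltNge => ->. Qed.

Lemma powk1 u : powk 1 u = (0 < u)%R%:R.
Proof. by rewrite /powk subrr powRr0; case: ifP. Qed.

Lemma powkM a c u : 0 < c -> powk a (c * u) = c `^ (a - 1) * powk a u.
Proof.
move=> c0; rewrite /powk pmulr_rgt0//; case: ifPn => u0; last by rewrite mulr0.
by rewrite powRM// ltW.
Qed.

Lemma powkD a b x : powk (a + b) x = x * (powk a x * powk b x).
Proof.
rewrite /powk; case: ifPn => x0; last by rewrite !mulr0.
rewrite -powRD ?(gt_eqF x0) ?implybT// -{2}(powRr1 (ltW x0)) -powRD.
  by congr (_ `^ _); ring.
by rewrite (gt_eqF x0) implybT.
Qed.

Lemma measurable_powk a : measurable_fun [set: R] (powk a).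
Proof.
by apply: measurable_fun_ifT => //; exact: measurable_fun_ltr.
Qed.

(** The substitution [s := x * s] pulls [powk a x * powk b x] out of the kernels, and its Jacobian
    [x] is the extra factor in [powkD]. Working in the extended reals avoids any question of
    convergence. *)
Lemma powk_conv a b x :
  (\int[mu]_s (powk a s * powk b (x - s))%:E =
   (powk (a + b) x)%:E * \int[mu]_s (powk a s * powk b (1 - s))%:E)%E.
Proof.
have [x0|x0] := leP x 0.
  rewrite (powk_le0 _ x0) mul0e; apply: integral0_eq => s _; congr EFin.
  have [s0|s0] := leP s 0; first by rewrite powk_le0// mul0r.
  by rewrite [powk b _]powk_le0 ?mulr0//; lra.
have xn0 : x != 0 by rewrite gt_eqF.
rewrite (integral_affine 0 xn0); first last.
- by move=> s; rewrite lee_fin mulr_ge0// powk_ge0.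
- apply/measurable_EFinP/measurable_funM; first exact: measurable_powk.
  by apply: (measurableT_comp (measurable_powk _)); exact: measurable_funB.
have -> : (\int[mu]_s (powk a (x * s + 0) * powk b (x - (x * s + 0)))%:E =
  (powk a x * powk b x)%:E * \int[mu]_s (powk a s * powk b (1 - s))%:E)%E.
  rewrite -ge0_integralZl//; first last.
  - by rewrite lee_fin mulr_ge0// powk_ge0.
  - by move=> s _; rewrite lee_fin mulr_ge0// powk_ge0.
  - apply/measurable_EFinP/measurable_funM; first exact: measurable_powk.
    by apply: (measurableT_comp (measurable_powk _)); exact: measurable_funB.
  apply: eq_integral => s _; rewrite -EFinM; congr EFin.
  rewrite addr0 (_ : x - x * s = x * (1 - s)); last by ring.
  by rewrite !powkM// {3 4}/powk x0; ring.
by rewrite muleA -EFinM gtr0_norm// -powkD.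
Qed.

(** Extended real values let the identities between Gamma and Beta integrals hold for all
    parameters; finiteness is then deduced from these identities. *)
Definition eGam a : \bar R := (\int[mu]_t (powk a t * expR (- t))%:E)%E.
Definition eBet a b : \bar R := (\int[mu]_s (powk a s * powk b (1 - s))%:E)%E.

Lemma measurable_powkB a x : measurable_fun [set: R] (fun s => powk a (x - s)).
Proof. by apply: (measurableT_comp (measurable_powk a)); exact: measurable_funB. Qed.

Lemma measurable_expN : measurable_fun [set: R] (fun t => expR (- t)).
Proof. by apply: measurableT_comp => //; exact: measurable_funN. Qed.

Lemma eGam_ge0 a : (0 <= eGam a)%E.
Proof. by apply: integral_ge0 => x _; rewrite lee_fin mulr_ge0 ?powk_ge0 ?expR_ge0. Qed.

Lemma eBet_ge0 a b : (0 <= eBet a b)%E.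
Proof. by apply: integral_ge0 => x _; rewrite lee_fin mulr_ge0 ?powk_ge0 ?expR_ge0. Qed.

(** Tonelli for [powk a s * powk b (x - s) * expR (- x)]: integrating first in [x] gives the product
    of the Gamma integrals, integrating first in [s] gives the convolution computed by
    [powk_conv]. *)
Lemma eGamM a b : (eGam a * eGam b = eBet a b * eGam (a + b))%E.
Proof.
have mge a' : measurable_fun [set: R] (fun t => (powk a' t * expR (- t))%:E).
  apply/measurable_EFinP/measurable_funM; first exact: measurable_powk.
  exact: measurable_expN.
have ge0e a' t : (0 <= (powk a' t * expR (- t))%:E)%E.
  by rewrite lee_fin mulr_ge0 ?powk_ge0 ?expR_ge0.
pose f (z : R * R) := (powk a z.1 * powk b (z.2 - z.1) * expR (- z.2))%:E.
have mf : measurable_fun [set: R * R] f.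
  apply/measurable_EFinP; apply: measurable_funM.
    apply: measurable_funM; first exact: (measurableT_comp (measurable_powk a)).
    by apply: (measurableT_comp (measurable_powk b)); exact: measurable_funB.
  exact: (measurableT_comp measurable_expN).
have f0 z : (0 <= f z)%E by rewrite lee_fin !mulr_ge0 ?powk_ge0 ?expR_ge0.
transitivity (\int[mu]_s \int[mu]_x f (s, x))%E.
  rewrite muleC -ge0_integralZl//; [|exact: mge|exact: eGam_ge0].
  apply: eq_integral => s _.
  rewrite muleC /eGam (integral_affine (- s) (oner_neq0 R))// normr1 mul1e.
  under [in LHS]eq_integral do rewrite mul1r.
  rewrite -ge0_integralZl//; first last.
    by have := mge b; move=> /measurable_EFinP/(measurableT_comp)h;
       apply/measurable_EFinP; apply: h; exact: measurable_funB.
  apply: eq_integral => x _; rewrite -EFinM; congr EFin => /=.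
  rewrite opprB expRD -[RHS]mulr1 -(expRxMexpNx_1 s); ring.
transitivity (\int[mu]_x \int[mu]_s f (s, x))%E.
  exact: (@fubini_tonelli _ _ (measurableTypeR R) (measurableTypeR R) R mu mu f mf f0).
transitivity (\int[mu]_x (eBet a b * (powk (a + b) x * expR (- x))%:E))%E.
  apply: eq_integral => x _.
  under eq_integral do rewrite /f/= EFinM muleC.
  rewrite ge0_integralZl//; first last.
  - by move=> s _; rewrite lee_fin mulr_ge0// powk_ge0.
  - by apply/measurable_EFinP/measurable_funM; [exact: measurable_powk|exact: measurable_powkB].
  by rewrite powk_conv -/(eBet a b) muleC [in RHS]muleC EFinM -muleA [in RHS]muleAC muleA.
by rewrite ge0_integralZl//; [exact: mge|exact: eBet_ge0].
Qed.

End Kernel.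

(** * Finiteness and functional equation of Gamma, the Beta-Gamma identity *)

Section GammaBeta.
Variable R : realType.
Local Notation mu := (@lebesgue_measure R).
Implicit Types a b c u x : R.

Lemma powR_continuous a x : 0 < x -> {for x, continuous (fun u => u `^ a)}.
Proof.
move=> x0; apply: (@differentiable_continuous R R R); apply/derivable1_diffP.
by case: (is_derive1_powR a x0).
Qed.

Lemma integral_powR a c : 0 < a -> 0 < c < 1 ->
  (\int[mu]_(x in `[c, 1%R]) (x `^ (a - 1))%:E = ((1 - c `^ a) / a)%:E)%E.
Proof.
move=> a0 /andP[c0 c1].
rewrite (@continuous_FTC2 _ _ (fun x => x `^ a / a))//.
- by rewrite powR1 -EFinB mulrBl.
- apply: continuous_in_subspaceT => x; rewrite inE/= in_itv/= => /andP[cx _].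
  by apply: powR_continuous; exact: lt_le_trans cx.
- split.
  + move=> x; rewrite in_itv/= => /andP[cx _].
    have x0 : 0 < x by exact: lt_trans cx.
    by apply: derivableM => //; case: (is_derive1_powR a x0).
  + apply: cvg_at_right_filter; apply: cvgM; last exact: cvg_cst.
    exact: powR_continuous.
  + apply: cvg_at_left_filter; apply: cvgM; last exact: cvg_cst.
    exact: powR_continuous.
- move=> x; rewrite in_itv/= => /andP[cx _].
  have x0 : 0 < x by exact: lt_trans cx.
  have [dx dE] := is_derive1_powR a x0.
  rewrite derive1E deriveM// derive_cst scaler0 add0r dE.
  by rewrite /GRing.scale/= mulrA mulVf ?mul1r// gt_eqF.
Qed.

(** The integrand may blow up at 0, so the fundamental theorem of calculus is used on intervals away
    from 0, followed by monotone convergence. *)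
Lemma eBetx1 a : 0 < a -> eBet a 1 = (a^-1)%:E.
Proof.
move=> a0.
have -> : eBet a 1 = (\int[mu]_(x in `]0%R, 1%R]) (x `^ (a - 1))%:E)%E.
  rewrite -integral_itv_bndo_bndc; last first.
    by apply/measurable_EFinP; apply: measurable_funTS; exact: measurable_powR.
  rewrite [RHS]integral_mkcond; apply: eq_integral => s _.
  rewrite patchE mem_setE in_itv/= powk1 /powk subr_gt0.
  by have [s0|s0] := ltP 0 s; have [s1|s1] := ltP s 1; rewrite /= ?mul0r ?mulr0 ?mulr1.
(* The left end points start at 1/2, since [integral_powR] needs them strictly below 1. *)
pose F (n : nat) : set R := `[n.+2%:R^-1, 1].
have n0 n : 0 < (n.+2%:R^-1 : R) by rewrite invr_gt0.
have n1 n : (n.+2%:R^-1 : R) < 1 by rewrite invf_lt1// ltr1n.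
have -> : `]0%R, 1%R]%classic = \bigcup_n F n.
  apply/seteqP; split => [x|x [n _]]; rewrite /F/= !in_itv/= => /andP[x0 x1].
    have [k _ /(_ k (leqnn k)) hk] := near_infty_natSinv_lt (PosNum x0).
    exists k => //=; rewrite /F/= in_itv/= x1 andbT ltW// (le_lt_trans _ hk)//.
    by rewrite lef_pV2 ?posrE// ler_nat.
  by rewrite x1 andbT (lt_le_trans _ x0).
have ndF : nondecreasing_seq F.
  move=> m n mn; apply/subsetPset => x; rewrite /F/= !in_itv/= => /andP[x0 ->].
  by rewrite andbT (le_trans _ x0)// lef_pV2 ?posrE// ler_nat.
have := @ge0_nondecreasing_set_cvg_integral _ (measurableTypeR R) R F (fun x => (x `^ (a - 1))%:E) mu
  ndF (fun=> measurable_itv _).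
have mp i : measurable_fun (F i) (fun x => (x `^ (a - 1))%:E).
  by apply/measurable_EFinP; apply: measurable_funTS; exact: measurable_powR.
move=> /(_ mp) /(_ _)H.
have {}H := H (fun _ x _ => powR_ge0 _ _).
have -> : (\int[mu]_(x in \bigcup_i F i) (x `^ (a - 1))%:E =
    limn (fun i => \int[mu]_(x in F i) (x `^ (a - 1))%:E))%E.
  by apply/esym/cvg_lim.
apply/cvg_lim => //.
rewrite (_ : (fun i => _) = (fun i => ((1 - i.+2%:R^-1 `^ a) / a)%:E)); last first.
  by apply/funext => i; rewrite /F integral_powR// n0 n1.
apply: cvg_EFin; first by near=> n.
rewrite -[X in _ --> X]mul1r; apply: cvgM; last exact: cvg_cst.
rewrite -[X in _ --> X]subr0; apply: cvgB; first exact: cvg_cst.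
have /cvg_at_rightP/(_ (fun n => n.+2%:R^-1)) := powR_cvg0 a0; apply.
split=> //; rewrite (cvg_shiftS (fun n => n.+1%:R^-1 : R)).
exact: cvg_harmonic.
Unshelve. all: by end_near. Qed.

Lemma eGam1 : eGam 1 = 1%:E :> \bar R.
Proof.
rewrite -(integral_exponential_pdf (@ltr01 R)).
transitivity (\int[mu]_(x in `[0%R, +oo[) (expR (- x))%:E)%E.
  rewrite -integral_itv_obnd_cbnd; last first.
    by apply: measurable_funTS; apply/measurable_EFinP; exact: measurable_expN.
  rewrite integral_mkcond; apply: eq_integral => s _.
  by rewrite patchE powk1 mem_setE in_itv/= andbT; case: ifP; rewrite ?mul0r// !mul1r.
rewrite integral_mkcond; apply: eq_integral => s _.
by rewrite /exponential_pdf !patchE; case: ifP => // _; rewrite mul1r mulN1r.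
Qed.

(** For [a <= 1] the kernel is at least 1 on []0, 1]] and at most 1 beyond. So the integral lies
    between [expR (-1) * eBet 1 1] and [eBet a 1 + eGam 1], both known. *)
Lemma eGam_small a : 0 < a <= 1 -> (0 < eGam a < +oo)%E.
Proof.
move=> /andP[a0 a1].
have mg : measurable_fun [set: R] (fun t => (powk a t * expR (- t))%:E).
  apply/measurable_EFinP/measurable_funM; first exact: measurable_powk.
  exact: measurable_expN.
have m1 b : measurable_fun [set: R] (fun s => (powk b s * powk 1 (1 - s))%:E).
  by apply/measurable_EFinP/measurable_funM; [exact: measurable_powk|exact: measurable_powkB].
have m2 : measurable_fun [set: R] (fun t => (powk 1 t * expR (- t))%:E).
  apply/measurable_EFinP/measurable_funM; first exact: measurable_powk.
  exact: measurable_expN.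
have g0 b t : (0 <= (powk b t * expR (- t))%:E)%E.
  by rewrite lee_fin mulr_ge0 ?powk_ge0 ?expR_ge0.
have b0 b t : (0 <= (powk b t * powk 1 (1 - t))%:E)%E.
  by rewrite lee_fin mulr_ge0 ?powk_ge0.
have p1 t : 0 < t <= 1 -> 1 <= powk a t.
  move=> /andP[t0 t1]; rewrite /powk t0 -[leLHS](powRr0 t).
  by rewrite ger_powR ?t0//; lra.
have p2 t : 1 <= t -> powk a t <= 1.
  move=> t1; have t0 : 0 < t by exact: lt_le_trans t1.
  by rewrite /powk t0 -[leRHS](powRr0 t) ler_powR//; lra.
apply/andP; split.
  apply: (@lt_le_trans _ _ (\int[mu]_s ((expR (-1))%:E * (powk 1 s * powk 1 (1 - s))%:E))%E).
    rewrite ge0_integralZl//; last exact: m1.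
    by rewrite -/(eBet 1 1) eBetx1// -EFinM lte_fin mulr_gt0 ?expR_gt0 ?invr_gt0.
  apply: ge0_le_integral => //.
  - by move=> s _; rewrite -EFinM lee_fin mulr_ge0 ?expR_ge0 ?mulr_ge0 ?powk_ge0.
  - by apply: measurable_funeM; exact: m1.
  - move=> s _; rewrite -EFinM lee_fin !powk1 subr_gt0.
    have [s0|s0] := leP s 0; first by rewrite mul0r mulr0 mulr_ge0 ?powk_ge0 ?expR_ge0.
    have [s1|s1] := leP 1 s; first by rewrite !mulr0 mulr_ge0 ?powk_ge0 ?expR_ge0.
    have h1 : 1 <= powk a s by apply: p1; rewrite s0 ltW.
    have h2 : expR (-1) <= expR (- s) by rewrite ler_expR lerN2 ltW.
    by rewrite !mulr1 -[leLHS]mul1r ler_pM ?expR_ge0.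
apply: (@le_lt_trans _ _ (eBet a 1 + eGam 1)%E); last by rewrite eBetx1// eGam1 -EFinD ltry.
rewrite /eBet /eGam -ge0_integralD//; last exact: m1.
apply: ge0_le_integral => //.
  by apply: emeasurable_funD; [exact: m1|exact: m2].
move=> s _; rewrite -EFinD lee_fin !powk1 subr_gt0.
have [s0|s0] := leP s 0; first by rewrite powk_le0// !mul0r addr0.
have [s1|s1] := leP 1 s.
  rewrite mulr0 add0r ler_wpM2r ?expR_ge0// p2//.
rewrite mulr1 mul1r; apply: (@le_trans _ _ (powk a s)); last by rewrite lerDl expR_ge0.
by rewrite ler_piMr ?powk_ge0// -expR0 ler_expR; lra.
Qed.

(** The case [b = 1] of [eGamM] replaces the usual integration by parts. *)
Lemma eGamS a : 0 < a -> (eGam a = a^-1%:E * eGam (a + 1))%E.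
Proof. by move=> a0; rewrite -eBetx1// -eGamM eGam1 mule1. Qed.

(** [eGamS] carries finiteness and positivity from [b - 1] to [b], starting from the parameters in
    []0, 1]]. *)
Lemma eGam_fin a : 0 < a -> (0 < eGam a < +oo)%E.
Proof.
move=> a0; suff H n : forall b, 0 < b <= n%:R -> (0 < eGam b < +oo)%E.
  by apply: (H (Num.truncn a).+1); rewrite a0/= ltW// truncnS_gt.
elim: n => [|n IH] b /andP[b0 bn]; first by move: (lt_le_trans b0 bn); rewrite ltxx.
have [b1|b1] := leP b 1; first by apply: eGam_small; rewrite b0 b1.
have /IH : 0 < b - 1 <= n%:R by move: bn; rewrite -natr1; lra.
rewrite eGamS ?subr_gt0// subrK.
have : 0 < (b - 1)^-1 by rewrite invr_gt0 subr_gt0.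
move: (eGam_ge0 b); case: (eGam b) => [r| |]//.
  by rewrite -EFinM !lte_fin !ltry !andbT => _ h; rewrite pmulr_rgt0.
by rewrite -lte_fin => _ h; rewrite gt0_muley//= ltxx andbF.
Qed.

Lemma eGamE a : 0 < a -> eGam a = (Gamma a)%:E.
Proof.
move=> a0.
have -> : Gamma a = fine (eGam a).
  rewrite /Gamma /Rintegral.
  rewrite integral_mkcond; congr fine; apply: eq_integral => s _.
  rewrite patchE mem_setE in_itv/= andbT /powk.
  by case: ifP; rewrite ?mul0r.
by have /andP[h1 h2] := eGam_fin a0; rewrite fineK// ge0_fin_numE ?eGam_ge0.
Qed.

Lemma Gamma_gt0 a : 0 < a -> 0 < Gamma a.
Proof. by move=> a0; have /andP[] := eGam_fin a0; rewrite eGamE. Qed.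

Lemma Gamma1 : Gamma 1 = 1 :> R.
Proof. by have := eGam1; rewrite eGamE// => -[]. Qed.

Lemma GammaS a : 0 < a -> Gamma (a + 1) = a * Gamma a.
Proof.
move=> a0; have := eGamS a0; rewrite !eGamE ?addr_gt0// -EFinM => -[->].
by rewrite mulVKf// gt_eqF.
Qed.

Lemma Gamma2 : Gamma 2 = 1 :> R.
Proof. by rewrite (_ : 2 = 1 + 1)// GammaS// Gamma1 mulr1. Qed.

(** In [eGamM] the left side is finite and [eGam (a + b)] is positive, so [eBet a b] cannot be
    infinite and the equation can be divided. *)
Lemma eBetE a b : 0 < a -> 0 < b -> eBet a b = (Gamma a * Gamma b / Gamma (a + b))%:E.
Proof.
move=> a0 b0; have ab0 : 0 < a + b by rewrite addr_gt0.
have := eGamM a b; rewrite !eGamE// -EFinM.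
have g0 := Gamma_gt0 ab0.
move: (eBet_ge0 a b); case: (eBet a b) => [r| |]//.
  by move=> _; rewrite -EFinM => -[->]; rewrite mulfK// gt_eqF.
by rewrite gt0_mulye.
Qed.

End GammaBeta.

(** * The Beta(2 - alpha, alpha) average and its moments *)

Section BetaAverage.
Variables (R : realType) (al : R).
Hypothesis al01 : 0 < al < 1.
Local Notation mu := (@lebesgue_measure R).
Implicit Types (t u s M : R) (f g : R -> R).

Let al0 : 0 < al. Proof. by case/andP: al01. Qed.
Let al1 : al < 1. Proof. by case/andP: al01. Qed.
Let al2 : 0 < 2 - al. Proof. by rewrite subr_gt0 (lt_trans al1)// ltr1n. Qed.

(** This fact and the next are the side conditions of [powR0], left to [//] below. *)
Let al_sub1 : al - 1 != 0. Proof. by rewrite subr_eq0 lt_eqF. Qed.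
Let sub1_al : 1 - al != 0. Proof. by rewrite subr_eq0 gt_eqF. Qed.

Lemma powk_conv_integrable a b x : 0 < a -> 0 < b ->
  mu.-integrable [set: R] (fun s : R => (powk a s * powk b (x - s))%:E).
Proof.
move=> a0 b0; apply/integrableP; split.
  by apply/measurable_EFinP/measurable_funM; [exact: measurable_powk|exact: measurable_powkB].
under eq_integral do rewrite gee0_abs ?lee_fin ?mulr_ge0 ?powk_ge0//.
by rewrite powk_conv -/(eBet a b) eBetE// -EFinM ltry.
Qed.

Definition betaw u : R := powk (2 - al) u * powk al (1 - u).

Lemma betaw_ge0 u : 0 <= betaw u.
Proof. by rewrite mulr_ge0 ?powk_ge0. Qed.

Lemma betaw_eq0 u : ~~ (0 < u < 1) -> betaw u = 0.
Proof.
rewrite negb_and -!leNgt /betaw => /orP[u0|u1]; first by rewrite powk_le0 ?mul0r.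
by rewrite [powk al _]powk_le0 ?mulr0// subr_le0.
Qed.

Lemma measurable_betaw : measurable_fun [set: R] betaw.
Proof. by apply: measurable_funM; [exact: measurable_powk|exact: measurable_powkB]. Qed.

(** As [Gamma 2 = 1], this is at once the Beta constant [B(2 - al, al)] and the constant in the
    definition of [LJ]. *)
Definition betac : R := Gamma al * Gamma (2 - al).

Lemma betac_gt0 : 0 < betac.
Proof. by rewrite mulr_gt0 ?Gamma_gt0. Qed.

Lemma integrable_betaw : mu.-integrable [set: R] (EFin \o betaw).
Proof. exact: powk_conv_integrable. Qed.

Lemma integrable_cbetaw c : mu.-integrable [set: R] (fun u => (c * betaw u)%:E).
Proof.
by under eq_fun do rewrite EFinM; exact: (integrableZl measurableT _ integrable_betaw).
Qed.

Lemma Rintegral_betawX k :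
  \int[mu]_u (betaw u * u ^+ k) = betac * (Gamma (k%:R + 2 - al) / (Gamma (k%:R + 2) * Gamma (2 - al))).
Proof.
have k0 : 0 < k%:R + 2 - al by rewrite -addrA ltr_wpDl.
transitivity (fine (eBet (k%:R + 2 - al) al)).
  congr fine; apply: eq_integral => u _; congr EFin.
  rewrite /betaw mulrAC; congr (_ * _); rewrite /powk.
  case: ifPn => u0; last by rewrite mul0r.
  rewrite -powR_mulrn ?ltW// -powRD ?(gt_eqF u0) ?implybT//.
  by congr (_ `^ _); ring.
rewrite eBetE//= subrK /betac.
have /gt_eqF h1 := Gamma_gt0 al2.
have /gt_eqF h2 : 0 < Gamma (k%:R + 2) :> R by rewrite Gamma_gt0// ltr_wpDl.
move: (Gamma _) (Gamma _) (Gamma _) (Gamma _) h1 h2 => x y z w h1 h2.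
by field; rewrite h1 h2.
Qed.

Lemma Rintegral_betaw : \int[mu]_u betaw u = betac.
Proof.
have := Rintegral_betawX 0; rewrite add0r Gamma2 mul1r divff ?mulr1; last first.
  by rewrite gt_eqF ?Gamma_gt0.
by move=> <-; apply: eq_Rintegral => u _; rewrite mulr1.
Qed.

Lemma beta_constE : beta_const al = betac.
Proof.
rewrite -Rintegral_betaw /beta_const Rintegral_mkcond; apply: eq_Rintegral => u _.
rewrite patchE mem_setE in_itv/=; case: ifPn => [/andP[u0 u1]|u01]; last first.
  rewrite betaw_eq0//; apply: contra u01 => /andP[u0 u1]; by rewrite !ltW.
(* At the end points [powR] returns 0 at base 0 for both exponents, even for the negative [al - 1],
   so the two integrands agree there as well. *)
rewrite /betaw /powk subr_gt0; case: ltP u0 => [u0 _|u0 u0'].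
  case: ltP u1 => [u1 _|u1 u1']; first by congr (_ `^ _ * _); ring.
  by rewrite (_ : 1 - u = 0) ?powR0 ?mulr0//; lra.
rewrite (_ : u = 0) ?powR0 ?mul0r//; lra.
Qed.

(** A bound on []0, 1[] suffices because [betaw] vanishes elsewhere, and it is satisfied by the
    monomials, which are unbounded on the line. *)
Definition bounded_on01 f := exists M, forall u, 0 < u < 1 -> `|f u| <= M.

Lemma integrable_betawM f : measurable_fun [set: R] f -> bounded_on01 f ->
  mu.-integrable [set: R] (fun u => (betaw u * f u)%:E).
Proof.
move=> mf [M fM].
apply: (@le_integrable _ (measurableTypeR R) R mu setT measurableT _ (fun u => (M * betaw u)%:E)).
- by apply/measurable_EFinP/measurable_funM => //; exact: measurable_betaw.
- move=> u _; rewrite !abse_EFin lee_fin normrM [leRHS]normrM ger0_norm ?betaw_ge0// mulrC.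
  have [u01|u01] := boolP (0 < u < 1); last by rewrite betaw_eq0// !mulr0.
  by rewrite ler_wpM2r ?betaw_ge0// (le_trans (fM _ u01))// ler_norm.
- exact: integrable_cbetaw.
Qed.

Definition bavg f : R := betac^-1 * \int[mu]_u (betaw u * f u).

Lemma eq_bavg f g : (forall u, 0 < u < 1 -> f u = g u) -> bavg f = bavg g.
Proof.
move=> fg; congr (_ * _); apply: eq_Rintegral => u _.
by have [/fg ->//|u01] := boolP (0 < u < 1); rewrite betaw_eq0// !mul0r.
Qed.

Lemma bavgD f g : measurable_fun [set: R] f -> measurable_fun [set: R] g ->
  bounded_on01 f -> bounded_on01 g -> bavg (fun u => f u + g u) = bavg f + bavg g.
Proof.
move=> mf mg bf bg; rewrite /bavg -mulrDr -RintegralD//; [|exact: integrable_betawM..].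
by congr (_ * _); apply: eq_Rintegral => u _; rewrite mulrDr.
Qed.

Lemma bavgZ c f : measurable_fun [set: R] f -> bounded_on01 f ->
  bavg (fun u => c * f u) = c * bavg f.
Proof.
move=> mf bf; rewrite /bavg mulrCA -(RintegralZl c measurableT); last exact: integrable_betawM.
by congr (_ * _); apply: eq_Rintegral => u _; rewrite mulrCA.
Qed.

Lemma ler_norm_bavg f g : measurable_fun [set: R] f -> measurable_fun [set: R] g ->
  bounded_on01 g ->
  (forall u, 0 < u < 1 -> `|f u| <= g u) -> `|bavg f| <= bavg g.
Proof.
move=> mf mg bg fg; have bf : bounded_on01 f.
  case: bg => M gM; exists M => u u01; rewrite (le_trans (fg _ u01))//.
  by rewrite (le_trans (ler_norm _))// gM.
have c0 : 0 < betac^-1 by rewrite invr_gt0 betac_gt0.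
rewrite /bavg normrM gtr0_norm// ler_pM2l//.
apply: (le_trans (le_normr_Rintegral measurableT (integrable_betawM mf bf))).
apply: le_Rintegral => //; [|exact: integrable_betawM|].
  apply: (integrable_norm (integrable_betawM mf bf)).
move=> u _; rewrite normrM ger0_norm ?betaw_ge0//.
have [u01|u01] := boolP (0 < u < 1); last by rewrite betaw_eq0// !mul0r.
by rewrite ler_wpM2l ?betaw_ge0// fg.
Qed.

Definition bmom k : R := bavg (fun u => u ^+ k).

Lemma bmomE k : bmom k = Gamma (k%:R + 2 - al) / (Gamma (k%:R + 2) * Gamma (2 - al)).
Proof. by rewrite /bmom /bavg Rintegral_betawX mulKf// gt_eqF ?betac_gt0. Qed.

Lemma bmom_gt0 k : 0 < bmom k.
Proof.
rewrite bmomE divr_gt0 ?mulr_gt0//; apply: Gamma_gt0 => //.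
by rewrite -addrA ltr_wpDl.
Qed.

Lemma ml_coefS n : ml_coef al n.+1 = bmom n * ml_coef al n.
Proof.
rewrite /ml_coef big_nat_recr//= exprS bmomE.
rewrite (_ : n.+1%:R + 1 = n%:R + 2 :> R); last by rewrite -natr1 -addrA.
set P := \prod_(_ <= _ < _) _; rewrite !invfM invrK; set G := Gamma (2 - al).
by move: P G (G ^+ n) (Gamma _) (Gamma _) => *; ring.
Qed.

Lemma ml_coef0 : ml_coef al 0 = 1.
Proof. by rewrite /ml_coef expr0 big_geq// mulr1 invr1. Qed.

Lemma ml_coef_gt0 n : 0 < ml_coef al n.
Proof. by elim: n => [|n IH]; rewrite ?ml_coef0// ml_coefS mulr_gt0// bmom_gt0. Qed.

(** Dominated convergence, with [betaw] as majorant, avoids any asymptotics of Gamma quotients. *)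
Lemma bmom_cvg0 : bmom n @[n --> \oo] --> (0 : R).
Proof.
rewrite -(mulr0 betac^-1); apply: cvgM; first exact: cvg_cst.
apply: fine_cvg; rewrite -[0%:E](_ : (\int[mu]_u (cst 0%E u))%E = _); last exact: integral0.
have mp n : measurable_fun [set: R] (fun u => (betaw u * u ^+ n)%:E).
  by apply/measurable_EFinP/measurable_funM; [exact: measurable_betaw|exact: measurable_funX].
have h1 : {ae mu, forall u, setT u -> (betaw u * u ^+ n)%:E @[n --> \oo] --> cst 0%E u}.
  apply: aeW => u _ /=; apply: cvg_EFin; first exact: nearW.
  have [/andP[u0 u1]|u01] := boolP (0 < u < 1).
    rewrite -(mulr0 (betaw u)); apply: cvgM; first exact: cvg_cst.
    by apply: cvg_expr; rewrite ger0_norm// ltW.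
  by under eq_fun do rewrite /= betaw_eq0// mul0r; exact: cvg_cst.
have h2 : {ae mu, forall u n, setT u -> (`|(betaw u * u ^+ n)%:E| <= (EFin \o betaw) u)%E}.
  apply: aeW => u n _; rewrite abse_EFin lee_fin normrM ger0_norm ?betaw_ge0//.
  have [/andP[u0 u1]|u01] := boolP (0 < u < 1); last by rewrite betaw_eq0// mul0r.
  by rewrite ler_piMr ?betaw_ge0// normrX exprn_ile1// ger0_norm ltW.
by have [_ _] := @dominated_convergence _ (measurableTypeR R) R mu setT measurableT
  (fun n u => (betaw u * u ^+ n)%:E) (cst 0%E) (EFin \o betaw) mp (measurable_cst _)
  h1 integrable_betaw h2.
Qed.

(** Once the integral is rescaled to [[0, 1]], the parameter [t] no longer occurs in the singular
    kernel but only in [f], which makes continuity in [t] a case of continuity under the integral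
    sign. *)
Lemma continuous_bavg f M : continuous f -> (forall s, `|f s| <= M) ->
  continuous (fun t => bavg (fun u => f (t * u))).
Proof.
move=> cf fM t; apply: cvgM; first exact: cvg_cst.
have mfu x : measurable_fun [set: R] (fun u => f (x * u)).
  apply: (measurableT_comp (continuous_measurable_fun cf)); exact: measurable_funM.
apply: (@continuity_under_integral R _ (measurableTypeR R) mu
  (fun x u => betaw u * f (x * u)) setT measurableT (t - 1) (t + 1) _ _
  (fun u => M * betaw u)).
- by move=> x _; apply: integrable_betawM => //; exists M => u _.
- apply: aeW => u _ x _; apply: cvgM; first exact: cvg_cst.
  apply: (@cvg_comp _ _ _ (fun z => z * u) f _ (nbhs (x * u))); last exact: cf.
  by apply: cvgM; [exact: cvg_id|exact: cvg_cst].
- exact: integrable_cbetaw.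
- move=> x _; apply: aeW => u _; rewrite normrM ger0_norm ?betaw_ge0// mulrC.
  by rewrite ler_wpM2r ?betaw_ge0.
- by rewrite inE/= in_itv/=; lra.
Qed.

Definition frJ f t : R := (Gamma al * Gamma (2 - al))^-1 *
  \int[mu]_(s in `[0, t]) ((t - s) `^ (al - 1) * s `^ (1 - al) * f s).

Lemma powk_prodE t s : (powk (2 - al) s * powk al (t - s)) =
  (fun s => (t - s) `^ (al - 1) * s `^ (1 - al)) \_ `[0, t] s.
Proof.
rewrite patchE mem_setE in_itv/=; case: ifPn => [/andP[u0 u1]|]; last first.
  rewrite negb_and -!ltNge => /orP[u0|u1].
    by rewrite powk_le0 ?mul0r// ltW.
  by rewrite [powk al _]powk_le0 ?mulr0// subr_le0 ltW.
rewrite /powk subr_gt0; case: ltP u0 => [u0 _|u0 u0'].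
  case: ltP u1 => [u1 _|u1 u1']; first by rewrite mulrC; congr (_ * _ `^ _); ring.
  by rewrite (_ : t - s = 0) ?powR0 ?mulr0 ?mul0r//; lra.
rewrite (_ : s = 0) ?[0 `^ (1 - al)]powR0 ?mul0r ?mulr0//; lra.
Qed.

Lemma frJ_powk f t : frJ f t = betac^-1 *
  \int[mu]_s (powk (2 - al) s * powk al (t - s) * f s).
Proof.
congr (_ * _); rewrite Rintegral_mkcond; apply: eq_Rintegral => s _.
by rewrite powk_prodE !patchE; case: ifP; rewrite // mul0r.
Qed.

Lemma eq_frJ f g t : (forall s, 0 <= s <= t -> f s = g s) -> frJ f t = frJ g t.
Proof.
move=> fg; congr (_ * _); apply: eq_Rintegral => s.
by rewrite inE/= in_itv/= => st; rewrite fg.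
Qed.

(** Substitution [s = t * u]: the exponents [1 - al] and [al - 1] add up to 0, so the powers of [t]
    cancel and only the Jacobian [t] is left. The point [t = 0] is treated apart because the
    substitution degenerates. *)
Lemma frJ_bavg f t M : measurable_fun [set: R] f -> (forall s, `|f s| <= M) ->
  0 <= t -> frJ f t = t * bavg (fun u => f (t * u)).
Proof.
move=> mf fM; rewrite le_eqVlt => /predU1P[<-|t0].
  rewrite mul0r frJ_powk (_ : (fun s => _) = (fun=> 0)) ?Rintegral_cst ?mul0r ?mulr0//.
  by apply/funext => s; rewrite powk_prodE patchE mem_setE in_itv/=; case: ifP; rewrite ?mul0r// => h;
     rewrite (_ : s = 0) ?[0 `^ (1 - al)]powR0 ?mul0r ?mulr0//; lra.
have tn0 : t != 0 by rewrite gt_eqF.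
have intf : mu.-integrable [set: R] (EFin \o (fun s => powk (2 - al) s * powk al (t - s) * f s)).
  have ii := powk_conv_integrable t al2 al0.
  apply: (@le_integrable _ (measurableTypeR R) R mu setT measurableT _
     (fun u => (M * (powk (2 - al) u * powk al (t - u)))%:E)).
  - apply/measurable_EFinP/measurable_funM => //.
    by apply: measurable_funM; [exact: measurable_powk|exact: measurable_powkB].
  - move=> u _; rewrite /= lee_fin normrM mulrC.
    by rewrite [leRHS]normrM ler_wpM2r// (le_trans (fM _))// ler_norm.
  - under eq_fun do rewrite EFinM.
    exact: (integrableZl measurableT _ ii).
rewrite frJ_powk (integral_affine_integrable 0 tn0 intf).2 gtr0_norm//.
rewrite /bavg mulrCA; congr (_ * (_ * _)); apply: eq_Rintegral => u _.
rewrite addr0; congr (_ * _); rewrite (_ : t - t * u = t * (1 - u)); last by ring.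
rewrite !powkM// mulrACA (_ : t `^ _ * _ = 1) ?mul1r//.
rewrite -powRD ?tn0 ?implybT//.
by rewrite (_ : 2 - al - 1 + (al - 1) = 0) ?powRr0//; ring.
Qed.

End BetaAverage.

(** * The scalar fractional integral on continuous functions over [[0, T]] *)

Section OnInterval.
Variables (R : realType) (al T : R).
Hypotheses (al01 : 0 < al < 1) (T0 : 0 < T).
Local Notation mu := (@lebesgue_measure R).
Implicit Types (t u s M : R) (f g : R -> R).

Local Notation contT f := {within `[0, T], continuous (f : R -> R)}.
Local Notation frJ := (frJ al).
Local Notation bavg := (bavg al).
Local Notation bmom := (bmom al).

(** Composition with [clamp] makes a function continuous on [[0, T]] continuous and bounded on the
    whole line, hence measurable there, and leaves [frJ] at points of [[0, T]] unchanged. *)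
Definition clamp t : R := Num.max 0 (Num.min t T).

Lemma clamp_itv t : 0 <= clamp t <= T.
Proof. by rewrite /clamp le_max ge_max ge_min !lexx !orbT (ltW T0). Qed.

Lemma clamp_id t : 0 <= t <= T -> clamp t = t.
Proof. by move=> /andP[t0 tT]; rewrite /clamp min_l// max_r. Qed.

Lemma continuous_clampf f : contT f -> continuous (fun t => f (clamp t)).
Proof.
move=> /subspace_continuousP cf t.
have ct := clamp_itv t.
have := cf (clamp t); rewrite /= in_itv/= => /(_ ct) h.
apply: (@cvg_comp _ _ _ clamp f _ (within `[0, T]%classic (nbhs (clamp t)))) => //.
move=> U /= hU.
have cc : {for t, continuous clamp}.
  apply: (@continuous_max R R (fun=> 0) (id \min (fun=> T)) t); first exact: cvg_cst.
  by apply: (@continuous_min R R id (fun=> T) t); [exact: cvg_id|exact: cvg_cst].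
have {}cc : nbhs t (fun s => `[0, T]%classic (clamp s) -> U (clamp s)) by exact: cc hU.
apply: filterS cc => s; apply.
by rewrite /= in_itv/=; exact: clamp_itv.
Qed.

Lemma bounded_clampf f : contT f -> exists M, forall t, `|f (clamp t)| <= M.
Proof.
move=> cf; have cn : contT (fun t => `|f t|).
  by move=> x; apply: cvg_norm; exact: cf.
have [c _ hc] := EVT_max (ltW T0) cn.
by exists `|f c| => t; apply: hc; rewrite in_itv/=; exact: clamp_itv.
Qed.

Lemma frJ_clamp f t : 0 <= t <= T -> frJ f t = frJ (fun s => f (clamp s)) t.
Proof.
move=> /andP[t0 tT]; apply: eq_frJ => s /andP[s0 st].
by rewrite clamp_id// s0 (le_trans st).
Qed.

Lemma measurable_clampM f t : contT f -> measurable_fun [set: R] (fun u => f (clamp (t * u))).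
Proof.
move=> cf; apply: (measurableT_comp (continuous_measurable_fun (continuous_clampf cf))).
exact: measurable_funM.
Qed.

Lemma frJ_avg f t : contT f -> 0 <= t <= T ->
  frJ f t = t * bavg (fun u => f (clamp (t * u))).
Proof.
move=> cf tT; rewrite frJ_clamp//; have [M fM] := bounded_clampf cf.
rewrite (@frJ_bavg R al al01 _ t M)//; last by case/andP: tT.
exact: (continuous_measurable_fun (continuous_clampf cf)).
Qed.

Lemma cont_frJ f : contT f -> contT (frJ f).
Proof.
move=> cf; have [M fM] := bounded_clampf cf.
have /continuous_subspaceT h : continuous (fun t => t * bavg (fun u => f (clamp (t * u)))).
  move=> t; apply: cvgM; first exact: cvg_id.
  exact: (continuous_bavg al01 (continuous_clampf cf) fM).
apply: (subspace_eq_continuous _ (h `[0, T]%classic)) => t; rewrite inE/= in_itv/= => tT.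
by rewrite /from_subspace/= frJ_avg.
Qed.

Lemma bnd01 f t : contT f -> bounded_on01 (fun u => f (clamp (t * u))).
Proof. by move=> /bounded_clampf[M fM]; exists M => u _. Qed.

Lemma contTD f g : contT f -> contT g -> contT (fun t => f t + g t).
Proof. by move=> cf cg x; apply: cvgD; [exact: cf|exact: cg]. Qed.

Lemma contTZ c f : contT f -> contT (fun t => c * f t).
Proof. by move=> cf x; apply: cvgM; [exact: cvg_cst|exact: cf]. Qed.

Lemma contT_cst c : contT (fun=> c).
Proof. by move=> x; exact: cvg_cst. Qed.

Lemma contT_sum (I : Type) (r : seq I) (P : pred I) (F : I -> R -> R) :
  (forall i, P i -> contT (F i)) -> contT (fun t => \sum_(i <- r | P i) F i t).
Proof.
move=> cF; elim: r => [|i r IH].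
  have -> : (fun t => \sum_(i <- [::] | P i) F i t) = (fun=> 0).
    by apply/funext => t; rewrite big_nil.
  exact: contT_cst.
have -> : (fun t => \sum_(j <- i :: r | P j) F j t) =
    (fun t => if P i then F i t + \sum_(j <- r | P j) F j t else \sum_(j <- r | P j) F j t).
  by apply/funext => t; rewrite big_cons.
by move: (cF i); case: (P i) => // /(_ isT) cFi; apply: contTD.
Qed.

Lemma contTX k : contT (fun t => t ^+ k).
Proof. by apply: continuous_subspaceT => x; exact: exprn_continuous. Qed.

Lemma frJD f g t : contT f -> contT g -> 0 <= t <= T ->
  frJ (fun s => f s + g s) t = frJ f t + frJ g t.
Proof.
move=> cf cg tT; rewrite !frJ_avg//; last exact: contTD.
by rewrite -mulrDr bavgD//; [exact: measurable_clampM..|exact: bnd01|exact: bnd01].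
Qed.

Lemma frJZ c f t : contT f -> 0 <= t <= T ->
  frJ (fun s => c * f s) t = c * frJ f t.
Proof.
move=> cf tT; rewrite !frJ_avg//; last exact: contTZ.
by rewrite bavgZ//; [rewrite mulrCA|exact: measurable_clampM|exact: bnd01].
Qed.

Lemma frJ0 t : frJ (fun=> 0) t = 0.
Proof.
rewrite /frJ (_ : (fun s => _) = (fun=> 0)); last by apply/funext => s; rewrite mulr0.
by rewrite Rintegral_mkcond (_ : _ \_ _ = (fun=> 0)) ?Rintegral_cst ?mul0r ?mulr0//;
  apply/funext => s; rewrite patchE; case: ifP.
Qed.

Lemma frJ_sum (I : Type) (r : seq I) (P : pred I) (F : I -> R -> R) t :
  (forall i, P i -> contT (F i)) -> 0 <= t <= T ->
  frJ (fun s => \sum_(i <- r | P i) F i s) t = \sum_(i <- r | P i) frJ (F i) t.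
Proof.
move=> cF tT; elim: r => [|i r IH].
  rewrite big_nil (_ : (fun s => _) = (fun=> 0)) ?frJ0//.
  by apply/funext => s; rewrite big_nil.
rewrite big_cons.
have -> : (fun t => \sum_(j <- i :: r | P j) F j t) =
    (fun t => if P i then F i t + \sum_(j <- r | P j) F j t else \sum_(j <- r | P j) F j t).
  by apply/funext => s; rewrite big_cons.
by move: (cF i); case: (P i) => // /(_ isT) cFi; rewrite frJD// ?IH//; exact: contT_sum.
Qed.

Lemma frJX k t : 0 <= t <= T -> frJ (fun s => s ^+ k) t = bmom k * t ^+ k.+1.
Proof.
move=> tT; rewrite frJ_avg//; last exact: contTX.
rewrite (@eq_bavg _ _ _ (fun u => t ^+ k * u ^+ k)); last first.
  move=> u /andP[u0 u1]; case/andP: tT => t0 tT; rewrite clamp_id ?exprMn//.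
  by rewrite mulr_ge0 ?(ltW u0)//= (le_trans _ tT)// ler_piMr// ltW.
rewrite bavgZ//; first by rewrite exprS /bmom [RHS]mulrC mulrA.
by exists 1 => u /andP[u0 u1]; rewrite normrX exprn_ile1// ger0_norm ltW.
Qed.

Lemma ler_norm_frJ f M k t : contT f -> 0 <= t <= T ->
  (forall s, 0 <= s <= T -> `|f s| <= M * s ^+ k) ->
  `|frJ f t| <= M * bmom k * t ^+ k.+1.
Proof.
move=> cf tT fM; have cM := contTZ (c := M) (@contTX k).
rewrite -mulrA -frJX// -frJZ//; last exact: contTX.
case/andP: (tT) => t0 _.
rewrite !frJ_avg// normrM ger0_norm// ler_wpM2l//.
apply: ler_norm_bavg => //; [exact: measurable_clampM|exact: (measurable_clampM _ cM)|
  exact: (bnd01 _ cM)|].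
by move=> u _; apply: fM; exact: clamp_itv.
Qed.

Definition frE g : R := (beta_const al)^-1 *
  \int[mu]_(u in `[0, 1]) (u `^ (1 - al) * (1 - u) `^ (al - 1) * g u).

Lemma frE_bavg g : frE g = bavg g.
Proof.
rewrite /frE /bavg beta_constE//; congr (_ * _).
rewrite Rintegral_mkcond; apply: eq_Rintegral => u _.
by rewrite /betaw (powk_prodE al01) !patchE; case: ifP => _; rewrite ?mul0r// [u `^ _ * _]mulrC.
Qed.

(** Induction step for the nested expectations: the factor [u ^+ k] together with [t ^+ k] forms the
    power of [t * u] that turns [N] into [F]. Here [N] is controlled only after multiplication by
    [s ^+ k], so nothing is claimed about [N 0] when [k > 0]. *)
Lemma frE_frJ (F N : R -> R) k t : contT F ->
  (forall s, 0 <= s <= T -> s ^+ k * N s = F s) -> 0 <= t <= T ->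
  t ^+ k.+1 * frE (fun u => u ^+ k * N (t * u)) = frJ F t.
Proof.
move=> cF NF tT; rewrite frJ_avg//; case/andP: (tT) => t0 tleT.
move: t0; rewrite le_eqVlt => /predU1P[<-|t0]; first by rewrite expr0n/= !mul0r.
have tk : t ^+ k != 0 by rewrite expf_neq0// gt_eqF.
rewrite frE_bavg (@eq_bavg _ _ _ (fun u => (t ^+ k)^-1 * F (clamp (t * u)))); last first.
  move=> u /andP[u0 u1].
  have tu : 0 <= t * u <= T.
    by rewrite mulr_ge0 ?(ltW u0) ?(ltW t0)//= (le_trans _ tleT)// ler_piMr ?(ltW t0) ?(ltW u1).
  by rewrite clamp_id// -NF// exprMn -!mulrA mulKf.
rewrite bavgZ//; [|exact: measurable_clampM|exact: bnd01].
by rewrite exprS -mulrA mulVKf.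
Qed.

End OnInterval.

(** * Absolute continuity passes from increments to total variation *)

Section AbsCont.
Variable R : realType.
Implicit Types (T t u v e : R) (f : R -> R) (L : seq (R * R)).

(** Families are lists ordered from left to right, so that subdividing one interval amounts to
    replacing one entry by a list. *)
Definition itvs T L :=
  all (fun p => [&& 0 <= p.1, p.1 <= p.2 & p.2 <= T]) L &&
  pairwise (fun p q => p.2 <= q.1) L.

Definition total_length L : R := \sum_(p <- L) (p.2 - p.1).

(** The final inequality is not strict, so that it survives suprema over partitions. *)
Definition abs_cont T f := forall e, 0 < e -> exists2 del : R, 0 < del &
  forall L, itvs T L -> total_length L < del -> \sum_(p <- L) `|f p.2 - f p.1| <= e.

Lemma abs_cont_ord T f :
  (forall e : R, 0 < e -> exists2 del : R, 0 < del &
    forall (n : nat) (s t : 'I_n -> R),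
      (forall k, 0 <= s k /\ s k <= t k /\ t k <= T) ->
      (forall k l, k != l -> t k <= s l \/ t l <= s k) ->
      \sum_(k < n) (t k - s k) < del ->
      \sum_(k < n) `|f (t k) - f (s k)| < e) -> abs_cont T f.
Proof.
move=> acf e e0; have [del del0 H] := acf e e0; exists del => // L /andP[/allP aL pL] lL.
pose s (k : 'I_(size L)) := (nth (0, 0) L k).1.
pose t (k : 'I_(size L)) := (nth (0, 0) L k).2.
have hs : \sum_(k < size L) (t k - s k) < del.
  by move: lL; rewrite /total_length (big_nth (0, 0)) big_mkord.
rewrite (big_nth (0, 0)) big_mkord; apply/ltW/(H _ s t) => // [k|k l].
  by have /aL/and3P[] := mem_nth (0, 0) (ltn_ord k).
rewrite neq_ltn => /orP[] kl; [left|right];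
  by apply: (pairwiseP (0, 0) pL) => //; rewrite inE ltn_ord.
Qed.

Definition pieces u (l : seq R) : seq (R * R) := pairmap (fun x y => (x, y)) u l.

Lemma pieces_variation f u v l :
  \sum_(p <- pieces u l) `|f p.2 - f p.1| = variation u v f l.
Proof.
rewrite /variation /pieces; elim: l u => [|x l IH] u /=; first by rewrite big_nil big_geq.
by rewrite big_cons IH big_nat_recl//=; congr (_ + _).
Qed.

Lemma pieces_length u l : total_length (pieces u l) = last u l - u.
Proof.
rewrite /total_length /pieces; elim: l u => [|x l IH] u /=; first by rewrite big_nil subrr.
by rewrite big_cons IH /=; ring.
Qed.

Lemma pieces_bounds u l : path <%R u l ->
  all (fun p => [&& u <= p.1, p.1 <= p.2 & p.2 <= last u l]) (pieces u l) /\
  u <= last u l.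
Proof.
rewrite /pieces; elim: l u => [|x l IH] u //= /andP[ux /IH[/allP al xl]].
split; last exact: le_trans (ltW ux) xl.
rewrite lexx (ltW ux) xl /=; apply/allP => p /al /and3P[xp -> ->].
by rewrite (le_trans (ltW ux)).
Qed.

Lemma pieces_pairwise u l : path <%R u l -> pairwise (fun p q => p.2 <= q.1) (pieces u l).
Proof.
rewrite /pieces; elim: l u => [|x l IH] u //= /andP[ux hl].
rewrite IH// andbT; have [+ _] := pieces_bounds hl.
by apply: sub_all => p /and3P[].
Qed.

Lemma itvs_cat T L1 L2 : itvs T (L1 ++ L2) =
  [&& itvs T L1, itvs T L2 & allrel (fun p q => p.2 <= q.1) L1 L2].
Proof.
rewrite /itvs all_cat pairwise_cat.
case: (all _ L1); case: (all _ L2) => //=; rewrite ?andbF//.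
by case: allrel; case: pairwise => //=; rewrite ?andbF// andbT.
Qed.

Lemma itvs_pieces T u v L1 L2 l : itvs T (L1 ++ (u, v) :: L2) -> u < v ->
  itv_partition u v l -> itvs T (L1 ++ pieces u l ++ L2).
Proof.
move=> + uv [pl /eqP lv].
have [pb _] := pieces_bounds pl; rewrite lv in pb.
rewrite -cat1s !itvs_cat !allrel_catr => /and3P[-> /and3P[h1 -> h2] /andP[h3 ->]].
have /andP[/= u0 /andP[_ vT]] : [&& 0 <= u, u <= v & v <= T] by case/andP: h1 => /= /andP[].
rewrite /= andbT -andbA; apply/and3P; split.
- rewrite /itvs pieces_pairwise// andbT; apply: sub_all pb => p /andP[h /andP[-> h']].
  by rewrite (le_trans u0 h) (le_trans h' vT).
- apply/allrelP => p q /(allP pb)/and3P[_ _ h] qL2; apply: (le_trans h).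
  by move/allrelP : h2 => /(_ (u, v) q); apply => //; rewrite mem_head.
- apply/allrelP => p q pL1 /(allP pb)/and3P[h _ _]; apply: le_trans h.
  by move/allrelP : h3 => /(_ p (u, v)); apply => //; rewrite mem_head.
Qed.

Lemma itvs_subr T L1 L2 p : itvs T (L1 ++ p :: L2) -> itvs T (L1 ++ L2).
Proof.
rewrite -cat1s !itvs_cat !allrel_catr => /and3P[-> /and3P[_ -> _] /andP[_ ->]] //.
Qed.

Lemma total_length_cat L1 L2 : total_length (L1 ++ L2) = total_length L1 + total_length L2.
Proof. by rewrite /total_length big_cat. Qed.

(** The intervals are treated one at a time: those in [L1] already carry their total variation,
    those in [L2] still their increment. This mixed form is what makes the induction on [L1] go
    through. *)
Lemma total_variation_list f T e del :
  (forall L, itvs T L -> total_length L < del -> \sum_(p <- L) `|f p.2 - f p.1| <= e) ->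
  forall L1 L2, itvs T (L1 ++ L2) -> total_length (L1 ++ L2) < del ->
  (\sum_(p <- L1) total_variation p.1 p.2 f + (\sum_(p <- L2) `|f p.2 - f p.1|)%:E <= e%:E)%E.
Proof.
move=> H; elim/last_ind => [|L1 [u v] IH] L2 iL lL.
  by rewrite big_nil add0e lee_fin H.
move: iL lL; rewrite cat_rcons => iL lL.
rewrite -cats1 big_cat big_seq1 /=.
have /andP[/= u0 /andP[uv vT]] : [&& 0 <= u, u <= v & v <= T].
  by move: iL; rewrite itvs_cat => /and3P[_ /andP[/= /andP[]]].
have ge0 : (0 <= \sum_(p <- L1) total_variation p.1 p.2 f)%E.
  rewrite big_seq; apply: sume_ge0 => p pL1; apply: total_variation_ge0.
  by move: iL; rewrite itvs_cat => /and3P[/andP[/allP/(_ _ pL1)/and3P[]]].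
(* A degenerate interval contributes 0 and is dropped; subdividing requires [u < v]. *)
move: uv; rewrite le_eqVlt => /predU1P[uv|uv].
  rewrite uv total_variationxx adde0; apply: IH; first exact: itvs_subr iL.
  by move: lL; rewrite !total_length_cat /total_length big_cons /= uv subrr add0r.
(* The interval moves from [L1] to [L2], cut along an arbitrary partition; the total length does not
   change, so the induction hypothesis applies with the same [del]. *)
have key l : itv_partition u v l ->
    (\sum_(p <- L1) total_variation p.1 p.2 f + (variation u v f l)%:E +
      (\sum_(p <- L2) `|f p.2 - f p.1|)%:E <= e%:E)%E.
  move=> pl; rewrite -(pieces_variation f u v l) -addeA -EFinD -big_cat /=; apply: IH.
    exact: itvs_pieces iL uv pl.
  move: lL; rewrite !total_length_cat pieces_length.
  by case: (pl) => _ /eqP ->; rewrite {2}/total_length big_cons.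
(* The one-piece partition bounds the sum over [L1]; being finite, this sum can be subtracted before
   the supremum over partitions is taken. *)
have fS : \sum_(p <- L1) total_variation p.1 p.2 f \is a fin_num.
  rewrite ge0_fin_numE//; have [l0 pl0] : exists l, itv_partition u v l.
    by exists [:: v]; exact: itv_partition1.
  rewrite (le_lt_trans _ (ltry e))// (le_trans _ (key _ pl0))//.
  by rewrite -addeA leeDl// -EFinD lee_fin -(pieces_variation f u) addr_ge0// sumr_ge0.
rewrite -(fineK fS) in key *; set S := fine _ in key *; set D := \sum_(p <- L2) _ in key *.
clear ge0; suff : (total_variation u v f <= (e - D - S)%:E)%E.
  move: (total_variation_ge0 f (ltW uv)); case: (total_variation u v f) => [r| |]// _.
  by rewrite -!EFinD !lee_fin; lra.
apply: ge_ereal_sup => _ [_ [l pl <-] <-]; rewrite lee_fin.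
by have := key _ pl; rewrite -!EFinD lee_fin; lra.
Qed.

End AbsCont.

Section TVFun.
Variables (R : realType) (T : R) (f : R -> R).
Hypothesis acf : abs_cont T f.
Local Notation TV := total_variation.

Lemma abs_cont_TV_small (e : R) : 0 < e -> exists2 del : R, 0 < del & forall L,
  itvs T L -> total_length L < del -> (\sum_(p <- L) TV p.1 p.2 f <= e%:E)%E.
Proof.
move=> e0; have [del del0 H] := acf e0; exists del => // L iL lL.
have := total_variation_list H (L1 := L) (L2 := [::]).
by rewrite cats0 big_nil adde0; apply.
Qed.

Lemma itvs1 (u v : R) : itvs T [:: (u, v)] = [&& 0 <= u, u <= v & v <= T].
Proof. by rewrite /itvs /= !andbT. Qed.

(** [[0, t]] is crossed in finitely many steps of length at most [del / 2], strictly below [del],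
    each contributing a variation of at most 1. *)
Lemma abs_cont_TV_fin (t : R) : 0 <= t <= T -> TV 0 t f \is a fin_num.
Proof.
have [del del0 H] := abs_cont_TV_small (@ltr01 R).
have dE : 0 < del / 2 by rewrite divr_gt0.
suff K n : forall t, 0 <= t <= T -> t <= n%:R * (del / 2) -> TV 0 t f \is a fin_num.
  move=> tT; apply: (K (Num.truncn (t / (del / 2))).+1) => //.
  by rewrite -ler_pdivrMr// ltW// truncnS_gt.
elim: n => [|n IH] {}t /andP[t0 tT] tn.
  have -> : t = 0 by apply/eqP; rewrite eq_le t0 andbT; move: tn; rewrite mul0r.
  by rewrite total_variationxx.
have [td|td] := leP t (del / 2).
  rewrite ge0_fin_numE ?total_variation_ge0// (le_lt_trans _ (ltry 1))//.
  have := H [:: (0, t)]; rewrite itvs1 /total_length !big_seq1/= lexx t0 tT subr0; apply => //.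
  by lra.
have t20 : 0 <= t - del / 2 by rewrite subr_ge0 ltW.
have t2t : t - del / 2 <= t by rewrite gerBl ltW.
rewrite (total_variationD f t20 t2t) fin_numD; apply/andP; split.
  apply: IH; first by rewrite t20 (le_trans t2t).
  by rewrite lerBlDr; move: tn; rewrite -natr1 mulrDl mul1r.
rewrite ge0_fin_numE ?total_variation_ge0// (le_lt_trans _ (ltry 1))//.
have := H [:: (t - del / 2, t)]; rewrite itvs1 /total_length !big_seq1/= t20 t2t tT; apply => //.
by lra.
Qed.

Definition tvf (t : R) : R := fine (TV 0 t f).

Lemma tvfB (u v : R) : 0 <= u -> u <= v -> v <= T -> TV u v f = (tvf v - tvf u)%:E.
Proof.
move=> u0 uv vT; have hu : 0 <= u <= T by rewrite u0 (le_trans uv).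
have hv : 0 <= v <= T by rewrite vT (le_trans u0).
have := total_variationD f u0 uv; rewrite /tvf.
move: (abs_cont_TV_fin hv) (abs_cont_TV_fin hu) (total_variation_ge0 f uv).
case: (TV 0 v f) => // a _; case: (TV 0 u f) => // b _.
case: (TV u v f) => [c| |]// _; rewrite -EFinD => -[->] /=.
by congr EFin; ring.
Qed.

Lemma ler_norm_tvf (u v : R) : 0 <= u -> u <= v -> v <= T -> `|f v - f u| <= tvf v - tvf u.
Proof.
by move=> u0 uv vT; have := total_variation_ge f uv; rewrite tvfB// lee_fin.
Qed.

Lemma tvf_list (e : R) : 0 < e -> exists2 del : R, 0 < del & forall L,
  itvs T L -> total_length L < del -> \sum_(p <- L) (tvf p.2 - tvf p.1) <= e.
Proof.
move=> /abs_cont_TV_small[del del0 H]; exists del => // L iL lL.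
rewrite -lee_fin -sumEFin; have := H _ iL lL; rewrite big_seq [in X in _ -> X]big_seq.
rewrite (eq_bigr (fun p => (tvf p.2 - tvf p.1)%:E))// => p pL.
by case/andP: iL => /allP/(_ _ pL)/and3P[p0 p12 pT] _; exact: tvfB.
Qed.

End TVFun.

(** * Density of a nondecreasing absolutely continuous function *)

Section Stieltjes.
Variables (R : realType) (T : R) (W : R -> R).
Hypothesis T0 : 0 < T.
Local Notation mu := (@lebesgue_measure R).
Hypothesis Wnd : forall u v : R, 0 <= u -> u <= v -> v <= T -> W u <= W v.
Hypothesis Wac : forall e : R, 0 < e -> exists2 del : R, 0 < del & forall L,
  itvs T L -> total_length L < del -> \sum_(p <- L) (W p.2 - W p.1) <= e.

(** A cumulative function lives on the whole line; clamping makes it constant outside [[0, T]]. *)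
Let V (t : R) : R := W (clamp T t).

Lemma ler_clamp (u v : R) : u <= v -> clamp T u <= clamp T v.
Proof.
move=> uv; rewrite /clamp ge_max le_max lexx/= le_max.
have -> : Num.min u T <= Num.min v T; last by rewrite orbT.
by rewrite le_min !ge_min lexx uv orbT.
Qed.

Lemma clampB (u v : R) : u <= v -> clamp T v - clamp T u <= v - u.
Proof.
move=> uv; rewrite /clamp /Num.max /Num.min.
by case: (ltP v T) => h1; case: (ltP u T) => h2; case: ltP => h3; case: ltP => h4; lra.
Qed.

Let Vnd : nondecreasing V.
Proof.
move=> u v uv; apply: Wnd.
- by case/andP: (clamp_itv T0 u).
- exact: ler_clamp.
- by case/andP: (clamp_itv T0 v).
Qed.

Let Vrc : right_continuous V.
Proof.
move=> t; apply/cvgrPdist_le => e e0.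
have [del del0 H] := Wac e0.
near=> s.
have ts : t <= s by near: s; exact: nbhs_right_ge.
have hs : s - t < del by rewrite ltrBlDl; near: s; apply: nbhs_right_lt; rewrite ltrDl.
rewrite distrC ger0_norm ?subr_ge0 ?Vnd//.
have := H [:: (clamp T t, clamp T s)].
rewrite itvs1 /total_length !big_seq1 /=; apply.
  rewrite ler_clamp//=; apply/andP; split.
    by case/andP: (clamp_itv T0 t).
  by case/andP: (clamp_itv T0 s).
exact: le_lt_trans (clampB ts) hs.
Unshelve. all: by end_near. Qed.

Let Vc : cumulative R R := HB.pack V (isCumulative.Build R _ R V Vnd Vrc).
Let nu := lebesgue_stieltjes_measure Vc.

Let nuE (a b : R) : a <= b -> nu `]a, b]%classic = (V b - V a)%:E.
Proof.
move=> ab; rewrite /nu /lebesgue_stieltjes_measure /measure_extension.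
rewrite measurable_mu_extE; last exact: is_ocitv.
exact: (wlength_itv_bnd V false false ab).
Qed.

(** [Wac] speaks of finite families of intervals, whereas a null set is enclosed in an arbitrary
    open set. Dyadic cells bridge the gap: an open set is exhausted, within []0, T]], by finite
    unions of the cells it contains. *)
Let cell n k : set R := `]k%:R * T / 2 ^+ n, k.+1%:R * T / 2 ^+ n]%classic.

Let cell_le n k : k%:R * T / 2 ^+ n <= k.+1%:R * T / 2 ^+ n.
Proof. by rewrite ler_pM2r ?invr_gt0// ler_pM2r// ler_nat. Qed.

Let cell_itv n k : (k < 2 ^ n)%N ->
  0 <= k%:R * T / 2 ^+ n /\ k.+1%:R * T / 2 ^+ n <= T.
Proof.
move=> kn; split; first by rewrite divr_ge0 ?mulr_ge0// ltW.
by rewrite ler_pdivrMr// mulrC ler_pM2l// -natrX ler_nat.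
Qed.

Let Vcell n k : (k < 2 ^ n)%N -> nu (cell n k) =
  (W (k.+1%:R * T / 2 ^+ n) - W (k%:R * T / 2 ^+ n))%:E.
Proof.
move=> kn; have [c1 c2] := cell_itv kn; have c3 := cell_le n k.
by rewrite nuE// /V !clamp_id ?c1 ?c2 ?(le_trans c1)// (le_trans c3).
Qed.

Let mucell n k : mu (cell n k) = (k.+1%:R * T / 2 ^+ n - k%:R * T / 2 ^+ n)%:E.
Proof.
rewrite lebesgue_measure_itv /= lte_fin ifT ?EFinB//.
by rewrite ltr_pM2r ?invr_gt0// ltr_pM2r// ltr_nat.
Qed.

Let trivcell n : trivIset [set: nat] (cell n).
Proof.
apply/trivIsetP => i j _ _; rewrite neq_ltn => /orP[] ij; apply/seteqP; split => x //=;
  rewrite /cell /= !in_itv/= => -[/andP[h1 h2] /andP[h3 h4]].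
  have : (j%:R : R) * T / 2 ^+ n < i.+1%:R * T / 2 ^+ n by exact: lt_le_trans h3 h2.
  by rewrite ltr_pM2r ?invr_gt0// ltr_pM2r// ltr_nat ltnS leqNgt ij.
have : (i%:R : R) * T / 2 ^+ n < j.+1%:R * T / 2 ^+ n by exact: lt_le_trans h1 h4.
by rewrite ltr_pM2r ?invr_gt0// ltr_pM2r// ltr_nat ltnS leqNgt ij.
Qed.

Let P (U : set R) n (k : nat) : bool := `[< cell n k `<=` U >].
Let UU (U : set R) n : set R := \big[setU/set0]_(k < 2 ^ n | P U n k) cell n k.

Let mcell n k : measurable (cell n k). Proof. exact: measurable_itv. Qed.

Let mUU U n : measurable (UU U n).
Proof. by apply: bigsetU_measurable => k _; exact: mcell. Qed.

(** The chosen cells are disjoint and lie in [U], so their total length is below [del], while the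
    sum of their [W]-increments is the [nu]-measure of their union. *)
Let UU_small U n (e del : R) :
  (forall L, itvs T L -> total_length L < del -> \sum_(p <- L) (W p.2 - W p.1) <= e) ->
  measurable U -> (mu U < del%:E)%E -> (nu (UU U n) <= e%:E)%E.
Proof.
move=> H mU Ud.
pose b k : R := k%:R * T / 2 ^+ n.
pose L := [seq (b k, b k.+1) | k <- iota 0 (2 ^ n) & P U n k].
have sumL (g : R * R -> R) : \sum_(p <- L) g p = \sum_(k < 2 ^ n | P U n k) g (b k, b k.+1).
  by rewrite big_map big_filter (_ : iota _ _ = index_iota 0 (2 ^ n)) ?big_mkord// /index_iota subn0.
have tr : trivIset (fun k : 'I_(2 ^ n) => P U n k) (fun k : 'I_(2 ^ n) => cell n k).
  move=> i j _ _ h; apply: ord_inj; exact: (trivcell (n := n)) h.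
have iL : itvs T L.
  apply/andP; split.
    apply/allP => x /mapP[k]; rewrite mem_filter mem_iota => /and3P[_ _ kn] ->{x}.
    by have [-> ->] := cell_itv kn; rewrite cell_le.
  rewrite pairwise_map; apply: pairwise_filter.
  have := iota_ltn_sorted 0 (2 ^ n); rewrite (sorted_pairwise ltn_trans).
  apply: sub_pairwise => i j ij /=.
  by rewrite ler_pM2r ?invr_gt0// ler_pM2r// ler_nat.
have lL : total_length L < del.
  rewrite /total_length sumL -lte_fin -sumEFin; apply: le_lt_trans Ud.
  have e1 : mu (UU U n) = (\sum_(k < 2 ^ n | P U n k) mu (cell n k))%E.
    exact: (measure_bigsetU_ord_cond mu (fun i _ => mcell n i) tr).
  apply: (@le_trans _ _ (mu (UU U n))).
    by rewrite e1; apply: lee_sum => k _; rewrite mucell.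
  apply: le_measure; rewrite ?inE//; first exact: mUU.
  rewrite /UU; apply: (big_ind (fun A => A `<=` U)) => [|A B AU BU|k /asboolP//].
    exact: sub0set.
  by rewrite subUset.
have := H _ iL lL; rewrite sumL -lee_fin -sumEFin; apply: le_trans.
have -> : nu (UU U n) = (\sum_(k < 2 ^ n | P U n k) nu (cell n k))%E.
  exact: (measure_bigsetU_ord_cond nu (fun i _ => mcell n i) tr).
by apply: lee_sum => k _; rewrite Vcell.
Qed.

Let UU_nd U : nondecreasing_seq (UU U).
Proof.
apply/nondecreasing_seqP => n; apply/subsetPset; rewrite {1}/UU.
apply: (big_ind (fun A => A `<=` UU U n.+1)) => [|A B AU BU|k /asboolP kU].
- exact: sub0set.
- by rewrite subUset.
move=> x kx; have xk := kx; rewrite /cell/= in_itv/= in kx; case/andP: kx => x1 x2.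
(* The midpoint: cell [k] is the union of cells [2k] and [2k + 1] of the next generation, both still
   inside [U]. *)
pose m := k%:R * T / 2 ^+ n + T / 2 ^+ n.+1.
have p2 : (2 : R) ^+ n.+1 = 2 * 2 ^+ n by rewrite exprS.
have n0 : (2 : R) ^+ n != 0 by rewrite gt_eqF.
have E0 : (k.*2)%:R * T / 2 ^+ n.+1 = k%:R * T / 2 ^+ n.
  by rewrite p2 -muln2 natrM; field.
have E1 : (k.*2).+1%:R * T / 2 ^+ n.+1 = m.
  by rewrite /m p2 -natr1 -muln2 natrM; field.
have E2 : (k.*2).+2%:R * T / 2 ^+ n.+1 = k.+1%:R * T / 2 ^+ n.
  by rewrite p2 -!natr1 -muln2 natrM; field.
have mh : k%:R * T / 2 ^+ n <= m <= k.+1%:R * T / 2 ^+ n.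
  by rewrite -E0 -E1 -E2 !cell_le.
case/andP: mh => mh1 mh2.
have kn1 : (k.*2 < 2 ^ n.+1)%N by rewrite expnS mul2n ltn_double.
have kn2 : (k.*2.+1 < 2 ^ n.+1)%N by rewrite expnS mul2n -doubleS leq_double.
rewrite /UU -bigcup_seq_cond.
have [xm|xm] := leP x m.
  exists (Ordinal kn1); last by rewrite /cell/= in_itv/= E0 E1 x1 xm.
  rewrite /= mem_index_enum; apply/asboolP => y; rewrite /cell/= in_itv/= E0 E1 => /andP[y1 y2].
  by apply: kU; rewrite /cell/= in_itv/= y1 (le_trans y2).
exists (Ordinal kn2); last by rewrite /cell/= in_itv/= E1 E2 x2 xm.
rewrite /= mem_index_enum; apply/asboolP => y; rewrite /cell/= in_itv/= E1 E2 => /andP[y1 y2].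
by apply: kU; rewrite /cell/= in_itv/= y2 (le_lt_trans mh1).
Qed.

(** As soon as the cells are shorter than the radius of a ball around [x] inside [U], the cell
    containing [x] lies in [U]. *)
Let UU_cover U : open U -> U `&` `]0, T]%classic `<=` \bigcup_n UU U n.
Proof.
move=> oU x [Ux]; rewrite /= in_itv/= => /andP[x0 xT].
have [e /= e0 eU] := (open_nbhs_nbhs (conj oU Ux)).
have [n Tn] : exists n, T / 2 ^+ n < e.
  have eT : 0 < e / T by rewrite divr_gt0.
  have [n _ /(_ n (leqnn n))/= h] := near_infty_natSinv_expn_lt (PosNum eT).
  exists n; move: h; rewrite ltr_pdivlMr// mul1r mulrC => h; exact: h.
exists n => //.
have [k /andP[k1 k2]] : exists k : nat, k%:R * T / 2 ^+ n < x <= k.+1%:R * T / 2 ^+ n.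
  pose y := x * 2 ^+ n / T.
  have y0 : 0 < y by rewrite divr_gt0// mulr_gt0.
  have : exists k : nat, k%:R < y <= k.+1%:R.
    have : exists k : nat, y <= k%:R by exists (Num.truncn y).+1; rewrite ltW// truncnS_gt.
    (* The least natural number not below [y] is positive because [y > 0]; its predecessor is the
       index sought. *)
    case/ex_minnP => -[|k] yk mk; first by move: (lt_le_trans y0 yk); rewrite ltxx.
    exists k; rewrite yk andbT ltNge; apply/negP => /mk; by rewrite ltnn.
  case=> k /andP[k1 k2]; exists k.
  by rewrite ltr_pdivrMr// ler_pdivlMr// -ltr_pdivlMr// -ler_pdivrMr// k1 k2.
have kn : (k < 2 ^ n)%N.
  have : k%:R * T / 2 ^+ n < T by exact: lt_le_trans k1 xT.
  by rewrite ltr_pdivrMr// mulrC ltr_pM2l// -natrX ltr_nat.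
rewrite /UU -bigcup_seq_cond; exists (Ordinal kn); last by rewrite /cell/= in_itv/= k1 k2.
rewrite /= mem_index_enum; apply/asboolP => y; rewrite /cell/= in_itv/= => /andP[y1 y2].
apply: eU; rewrite /ball_/=.
have : k.+1%:R * T / 2 ^+ n - k%:R * T / 2 ^+ n < e.
  by rewrite -!mulrA -mulrBl -natr1 addrAC subrr add0r mul1r.
by rewrite ltr_norml; lra.
Qed.

Let D : set R := `]0, T]%classic.
Let mD : measurable D. Proof. exact: measurable_itv. Qed.
Let nuD : (nu D < +oo)%E. Proof. by rewrite nuE ?ltry// ltW. Qed.
(** The restriction to []0, T]] is a finite measure, and lives on the set that the dyadic cells
    cover. *)
Let nuD' : {finite_measure set (measurableTypeR R) -> \bar R} :=
  @mfrestr _ (measurableTypeR R) R D nu mD nuD.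

(** By outer regularity a null set lies in an open [U] of measure below [del]; continuity from below
    along the unions [UU U n] passes the bound of [UU_small] to the limit. *)
Let nuD'_dom : nuD' `<< mu.
Proof.
apply/null_content_dominatesP => N mN N0.
apply/eqP; rewrite eq_le measure_ge0 andbT; apply/lee_addgt0Pr => e e0; rewrite add0e.
have [del del0 H] := Wac e0.
have muN : (mu N < +oo)%E by rewrite N0.
have [U [oU NU Ud]] := lebesgue_regularity_outer mN muN del0.
have mU : measurable U by exact: open_measurable.
have {}Ud : (mu U < del%:E)%E.
  have -> : U = (U `\` N) `|` N by rewrite setUC setDUK.
  rewrite measureU//; [by rewrite N0 adde0|exact: measurableD|].
  by apply/seteqP; split=> x //= [[_ h] /h].
have cU := @nondecreasing_cvg_mu _ (measurableTypeR R) R nu (UU U) (mUU U) (bigcupT_measurable _ (mUU U)) (@UU_nd U).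
apply: (@le_trans _ _ (nu (\bigcup_n UU U n))).
  apply: (@le_measure _ _ _ nu (N `&` D)); rewrite ?inE.
  - exact: measurableI.
  - exact: (bigcupT_measurable _ (mUU U)).
  - by apply: subset_trans (UU_cover oU); exact: setSI.
have -> : nu (\bigcup_n UU U n) = limn (fun n => nu (UU U n)) by apply/esym/cvg_lim.
apply: lime_le.
  by apply/cvg_ex; eexists; exact: cU.
by apply: nearW => n; exact: UU_small H mU Ud.
Qed.

Lemma stieltjes_density : exists2 g : R -> R,
  mu.-integrable [set: R] (EFin \o g) &
  forall t, 0 <= t <= T -> W t - W 0 = \int[mu]_(s in `[0, t]) g s.
Proof.
have [h [h0 hfin hint hE]] := radon_nikodym_sigma_finite nuD'_dom.
have hfE : EFin \o (fine \o h) = h by apply/funext => x /=; rewrite fineK.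
exists (fine \o h); first by rewrite hfE.
move=> t /andP[t0 tT]; rewrite /Rintegral.
transitivity (fine (nu `]0, t]%classic)).
  by rewrite nuE//= /V !clamp_id ?lexx ?t0//= ltW.
congr fine; rewrite -integral_itv_obnd_cbnd; last first.
  by apply: measurable_funTS; rewrite -/(EFin \o (fine \o h)) hfE; exact: measurable_int hint.
transitivity (nuD' `]0, t]%classic).
  rewrite /nuD' /mfrestr /mrestr /=; congr nu; apply/seteqP; split => [x|x []//].
  rewrite /= !in_itv/= => /andP[x0 xt]; split; first by rewrite x0 xt.
  by rewrite /D/= in_itv/= x0 (le_trans xt).
by rewrite hE//; apply: eq_integral => x _; rewrite /= fineK.
Qed.

End Stieltjes.

Section Density.
Variables (R : realType) (T : R) (f : R -> R).
Hypotheses (T0 : 0 < T) (acf : abs_cont T f).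
Local Notation mu := (@lebesgue_measure R).

(** Jordan decomposition: [f] is the difference of [tvf f] and [tvf f - f], both nondecreasing and
    absolutely continuous, so each has a density. *)
Lemma abs_cont_density : exists2 g : R -> R,
  mu.-integrable [set: R] (EFin \o g) &
  forall t, 0 <= t <= T -> f t - f 0 = \int[mu]_(s in `[0, t]) g s.
Proof.
pose W1 := tvf f; pose W2 t := tvf f t - f t.
have vB := ler_norm_tvf acf.
have W1nd u v : 0 <= u -> u <= v -> v <= T -> W1 u <= W1 v.
  by move=> u0 uv vT; rewrite -subr_ge0 (le_trans _ (vB _ _ u0 uv vT)).
have W2nd u v : 0 <= u -> u <= v -> v <= T -> W2 u <= W2 v.
  by move=> u0 uv vT; have := vB _ _ u0 uv vT; rewrite /W2 ler_norml; lra.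
have W1ac := tvf_list acf.
have W2ac e : 0 < e -> exists2 del : R, 0 < del & forall L,
    itvs T L -> total_length L < del -> \sum_(p <- L) (W2 p.2 - W2 p.1) <= e.
  (* Increments of [W2] are at most twice those of [W1], whence [e / 2]. *)
  move=> e0; have e20 : 0 < e / 2 by rewrite divr_gt0.
  have [del del0 H] := W1ac _ e20; exists del => // L iL lL.
  have := H _ iL lL; rewrite -(ler_pM2r (ltr0n R 2)) divfK// => {}H.
  apply: le_trans H; rewrite mulr_suml big_seq [leRHS]big_seq; apply: ler_sum => p pL.
  case/andP: iL => /allP/(_ _ pL)/and3P[p0 p12 pT] _.
  by have := vB _ _ p0 p12 pT; rewrite /W2 ler_norml; lra.
have [g1 ig1 E1] := stieltjes_density T0 W1nd W1ac.
have [g2 ig2 E2] := stieltjes_density T0 W2nd W2ac.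
exists (fun s => g1 s - g2 s).
  have := integrableB measurableT ig1 ig2; apply: eq_integrable => //= s _.
move=> t tT; rewrite RintegralB//; [|exact: integrableS ig1|exact: integrableS ig2].
by rewrite -E1// -E2// /W2 /W1; ring.
Qed.

End Density.

(** * Integrals of functions equal almost everywhere, without measurability *)

Section NullSets.
Context d (X : measurableType d) (R : realType) (mu : {measure set X -> \bar R}).
Implicit Types (D : set X) (f g : X -> R).
Import HBNNSimple.

(** The integral is a supremum over simple functions below [f]. Multiplying such a function by the
    indicator of the complement of the null set keeps its integral and puts it below [g]; only the
    simple functions need to be measurable. *)
Lemma ge0_ae_le_integralT (f g : X -> \bar R) :
  (forall x, 0 <= f x)%E -> (forall x, 0 <= g x)%E ->
  {ae mu, forall x, (f x <= g x)%E} -> (\int[mu]_x f x <= \int[mu]_x g x)%E.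
Proof.
move=> f0 g0 [N [mN N0 fgN]].
rewrite ge0_integralTE// (ge0_integralTE _ g0); apply: ge_ereal_sup => _ [h /= hf <-].
pose k := mul_nnsfun h (indic_nnsfun R (measurableC mN)).
apply: ereal_sup_ubound; exists k => /=.
  move=> x; rewrite /k /= /mindic indicE in_setC; case: (boolP (x \in N)) => xN /=.
    by rewrite mulr0.
  rewrite mulr1 (le_trans (hf x))//; apply: contrapT => fg.
  by move: xN; rewrite notin_setE => /(_ (fgN _ fg)).
rewrite -!integralT_nnsfun; apply: ge0_ae_eq_integral => //.
- exact/measurable_EFinP/measurable_funP.
- exact/measurable_EFinP/measurable_funP.
- by move=> x _; rewrite lee_fin fun_ge0.
- by move=> x _; rewrite lee_fin fun_ge0.
exists N; split => // x /= /not_implyP[_ hx]; apply: contrapT => xN; apply: hx.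
by rewrite /k /= /mindic indicE in_setC memNset//= mulr1.
Qed.

(* [f] and [g] need not be measurable: the pointwise derivative in the Caputo integral
   is only known up to a null set. *)
Lemma ae_eq_Rintegral D f g : {ae mu, forall x, D x -> f x = g x} ->
  \int[mu]_(x in D) f x = \int[mu]_(x in D) g x.
Proof.
rewrite Rintegral_mkcond [RHS]Rintegral_mkcond => fg.
have {}fg : {ae mu, forall x, (f \_ D) x = (g \_ D) x}.
  apply: filterS fg => x fgx; rewrite !patchE; case: ifPn => // xD; apply: fgx; exact: set_mem.
rewrite /Rintegral integralE [in RHS]integralE; congr (fine (_ - _)).
  apply/eqP; rewrite eq_le; apply/andP; split; apply: ge0_ae_le_integralT => //;
    by apply: filterS fg => x fgx; rewrite !funeposE fgx.
apply/eqP; rewrite eq_le; apply/andP; split; apply: ge0_ae_le_integralT => //;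
  by apply: filterS fg => x fgx; rewrite !funenegE fgx.
Qed.

(* Unlike [RintegralZl], this needs no integrability: both sides are the junk value 0
   when [f] is not integrable. *)
Lemma measurable_RintegralZl f c : measurable_fun [set: X] f ->
  \int[mu]_x (c * f x) = c * \int[mu]_x f x.
Proof.
move=> mf; have [->|c0] := eqVneq c 0.
  by rewrite mul0r /Rintegral integral0_eq// => x _; rewrite mul0r.
have [intf|nintf] := pselect (mu.-integrable [set: X] (EFin \o f)).
  exact: RintegralZl.
have Z g : measurable_fun [set: X] g -> ~ mu.-integrable [set: X] (EFin \o g) ->
    \int[mu]_x g x = 0.
  move=> mg ng; rewrite /Rintegral integralE.
  have mEg : measurable_fun [set: X] (fun x => (g x)%:E) by exact/measurable_EFinP.
  have p0 : (0 <= \int[mu]_x ((fun x => (g x)%:E)^\+ x)%E)%E by exact: integral_ge0.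
  have n0 : (0 <= \int[mu]_x ((fun x => (g x)%:E)^\- x)%E)%E by exact: integral_ge0.
  move: p0 n0; case pE : (\int[mu]_x _)%E => [p| |]; case nE : (\int[mu]_x _)%E => [n| |]//.
  move=> _ _; case: ng; apply/integrableP; split => //.
  rewrite (eq_integral (fun x => ((fun x => (g x)%:E)^\+ x + (fun x => (g x)%:E)^\- x)%E)).
    rewrite ge0_integralD//; [|exact: measurable_funepos|exact: measurable_funeneg].
    by rewrite pE nE -EFinD ltry.
  by move=> x _; rewrite -/((abse \o (fun x => (g x)%:E)) x) fune_abse.
rewrite (Z _ mf nintf) mulr0; apply: Z; first exact: measurable_funM.
move=> h; apply: nintf; have := integrableZl measurableT c^-1 h.
by apply: eq_integrable => // x _ /=; rewrite -EFinM mulKf.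
Qed.

End NullSets.

(** * Composition of Riemann-Liouville integrals *)

Section Convolution.
Variable R : realType.
Local Notation mu := (@lebesgue_measure R).
Implicit Types (a b t s : R) (h : R -> R).

(** For [h] vanishing on the negative half-line this is [Gamma a] times the Riemann-Liouville
    integral of order [a]. Without the normalisation the composition law carries the factor
    [beta a b]. *)
Definition rlconv a h t : R := \int[mu]_s (powk a (t - s) * h s).

Lemma eq_rlconv a h1 h2 t : (forall s, s < t -> h1 s = h2 s) -> rlconv a h1 t = rlconv a h2 t.
Proof.
move=> h12; apply: eq_Rintegral => s _.
have [/h12->//|ts] := ltP s t; by rewrite powk_le0 ?mul0r// subr_le0.
Qed.

Lemma measurable_powk_conv a h t : measurable_fun [set: R] h ->
  measurable_fun [set: R] (fun s => powk a (t - s) * h s).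
Proof. by move=> mh; apply: measurable_funM => //; exact: measurable_powkB. Qed.

Definition beta a b : R := Gamma a * Gamma b / Gamma (a + b).

Lemma betaC a b : beta a b = beta b a.
Proof. by rewrite /beta (addrC a b); move: (Gamma a) (Gamma b) (Gamma _) => *; ring. Qed.

Lemma powk_conv_shift a b t r : 0 < a -> 0 < b ->
  (\int[mu]_s (powk a (t - s) * powk b (s - r))%:E = (powk (a + b) (t - r) * beta a b)%:E)%E.
Proof.
move=> a0 b0.
have m1 : measurable_fun [set: R] (fun s => (powk a (t - s) * powk b (s - r))%:E).
  apply/measurable_EFinP; apply: measurable_powk_conv.
  by apply: (measurableT_comp (measurable_powk b)); exact: measurable_funB.
rewrite (integral_affine r (oner_neq0 R) m1); last first.
  by move=> s; rewrite lee_fin mulr_ge0 ?powk_ge0.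
rewrite normr1 mul1e betaC addrC EFinM -(eBetE b0 a0) -powk_conv.
apply: eq_integral => s _; congr EFin; rewrite mul1r addrK mulrC; congr (_ * powk a _); ring.
Qed.

Lemma powk_le a t s : 1 <= a -> s < t -> 0 <= s -> powk a (t - s) <= t `^ (a - 1).
Proof.
move=> a1 st s0; rewrite /powk subr_gt0 st.
have t0 : 0 <= t by rewrite (le_trans s0)// ltW.
apply: ge0_ler_powR; rewrite ?nnegrE ?subr_ge0//; first exact: ltW.
by rewrite gerBl.
Qed.

(** With [1 <= a + b] the composed kernel is bounded on bounded sets, so Fubini applies at every
    [t], although [h] is only integrable and [rlconv b h] may diverge at some points. *)
Lemma rlconv_rlconv a b h t : 0 < a -> 0 < b -> 1 <= a + b ->
  mu.-integrable [set: R] (EFin \o h) -> (forall s, s < 0 -> h s = 0) ->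
  mu.-integrable [set: R] (EFin \o (fun s => powk a (t - s) * rlconv b h s)) /\
  rlconv a (rlconv b h) t = beta a b * rlconv (a + b) h t.
Proof.
move=> a0 b0 ab1 ih h0.
have /measurable_EFinP mh := measurable_int mu ih.
pose f (z : measurableTypeR R * measurableTypeR R) :=
  (powk a (t - z.1) * (powk b (z.1 - z.2) * h z.2))%:E.
have mf : measurable_fun [set: R * R] f.
  apply/measurable_EFinP; apply: measurable_funM.
    by apply: (measurableT_comp (measurable_powk a)); exact: measurable_funB.
  apply: measurable_funM; last exact: (measurableT_comp mh).
  by apply: (measurableT_comp (measurable_powk b)); exact: measurable_funB.
(* Tonelli with the singular kernels integrated first: what remains is the bounded kernel against
   [|h|]. *)
have inner r : (\int[mu]_s `|f (s, r)| = (beta a b * (powk (a + b) (t - r) * `|h r|))%:E)%E.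
  rewrite [RHS](_ : _ = (`|h r|%:E * (powk (a + b) (t - r) * beta a b)%:E)%E); last first.
    by rewrite -EFinM; congr EFin; ring.
  rewrite -powk_conv_shift// -ge0_integralZl//.
  - apply: eq_integral => s _; rewrite /f abse_EFin /= -EFinM; congr EFin.
    by rewrite !normrM (ger0_norm (powk_ge0 a _)) (ger0_norm (powk_ge0 b _)); ring.
  - apply/measurable_EFinP; apply: measurable_powk_conv.
    by apply: (measurableT_comp (measurable_powk b)); exact: measurable_funB.
  - by move=> s _; rewrite lee_fin mulr_ge0 ?powk_ge0.
have intab : mu.-integrable [set: R] (EFin \o (fun r => powk (a + b) (t - r) * h r)).
  apply: (@le_integrable _ (measurableTypeR R) R mu setT measurableT _
     (fun r => (t `^ (a + b - 1) * h r)%:E)).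
  - by apply/measurable_EFinP; exact: measurable_powk_conv.
  - move=> r _; rewrite /= lee_fin !normrM (ger0_norm (powk_ge0 _ _)) (ger0_norm (powR_ge0 _ _)).
    have [/h0->|r0] := ltP r 0; first by rewrite normr0 !mulr0.
    have [rt|tr] := ltP r t; first by rewrite ler_wpM2r// powk_le.
    by rewrite powk_le0 ?mul0r ?mulr_ge0 ?powR_ge0// subr_le0.
  - under eq_fun do rewrite EFinM.
    exact: (integrableZl measurableT _ ih).
have iprod : (mu \x mu)%E.-integrable [set: measurableTypeR R * measurableTypeR R] f.
  apply/(integrable21ltyP mu mu mf).
  rewrite [X in (X < _)%E](_ : _ =
      \int[mu]_r ((beta a b)%:E * `|(powk (a + b) (t - r) * h r)%:E|))%E; last first.
    apply: eq_integral => r _.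
    by rewrite inner abse_EFin -EFinM normrM ger0_norm ?powk_ge0.
  have /integrableP[mE lE] := intab.
  rewrite ge0_integralZl//.
  - by rewrite lte_mul_pinfty// lee_fin /beta divr_ge0 ?mulr_ge0// ltW ?Gamma_gt0// addr_gt0.
  - by apply: measurableT_comp => //; exact: mE.
  - by rewrite lee_fin /beta divr_ge0 ?mulr_ge0// ltW ?Gamma_gt0// addr_gt0.
(* Where the inner integral diverges both sides still agree through the default value 0, thanks to
   [measurable_RintegralZl]. *)
have FE s : (powk a (t - s) * rlconv b h s) = fine (fubini_F mu f s).
  rewrite /rlconv -measurable_RintegralZl//; exact: measurable_powk_conv.
have iF := integrable_fubini_F iprod.
split.
  apply: (@le_integrable _ (measurableTypeR R) R mu setT measurableT _ (fubini_F mu f)) => //.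
  - under [_ \o _]eq_fun do rewrite FE.
    apply/measurable_EFinP; apply: (measurableT_comp (fine_measurable measurableT)).
    exact: measurable_int iF.
  - by move=> s _; rewrite /= FE; case: (fubini_F mu f s) => [r| |] //=; rewrite ?leey.
rewrite {1}/rlconv.
transitivity (fine (\int[mu]_s fubini_F mu f s)%E).
  rewrite /Rintegral; congr fine; apply: ae_eq_integral => //.
  - under eq_fun do rewrite FE.
    apply/measurable_EFinP; apply: (measurableT_comp (fine_measurable measurableT)).
    exact: measurable_int iF.
  - exact: measurable_int iF.
  - have := integrable_ae measurableT iF; apply: filterS => s /(_ I) Fs _.
    by rewrite FE fineK.
rewrite /fubini_F (Fubini iprod) /rlconv -RintegralZl//; congr fine.
apply: eq_integral => r _.
transitivity ((h r)%:E * \int[mu]_s (powk a (t - s) * powk b (s - r))%:E)%E.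
  have iab : mu.-integrable [set: R] (fun s => (powk a (t - s) * powk b (s - r))%:E).
    apply/integrableP; split.
      apply/measurable_EFinP; apply: measurable_powk_conv.
      by apply: (measurableT_comp (measurable_powk b)); exact: measurable_funB.
    under eq_integral do rewrite gee0_abs ?lee_fin ?mulr_ge0 ?powk_ge0//.
    by rewrite powk_conv_shift// ltry.
  rewrite -integralZl//; apply: eq_integral => s _; rewrite /f /= -EFinM; congr EFin; ring.
by rewrite powk_conv_shift// -EFinM; congr EFin; ring.
Qed.

End Convolution.

(** * Almost everywhere differentiation of primitives *)

Section Primitive.
Variable R : realType.
Local Notation mu := (@lebesgue_measure R).
Implicit Types (t s T : R) (G x : R -> R).

Lemma ae_imp (P Q : R -> Prop) : (forall r, P r -> Q r) ->
  {ae mu, forall r, P r} -> {ae mu, forall r, Q r}.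
Proof.
move=> PQ [N [mN N0 PN]]; exists N; split => //.
by apply: subset_trans PN => x /= nQ Px; apply: nQ; exact: PQ.
Qed.

Lemma ae_imp2 (P1 P2 Q : R -> Prop) : (forall r, P1 r -> P2 r -> Q r) ->
  {ae mu, forall r, P1 r} -> {ae mu, forall r, P2 r} -> {ae mu, forall r, Q r}.
Proof.
move=> PQ [N [mN N0 PN]] [M [mM M0 PM]]; exists (N `|` M); split.
- exact: measurableU.
- apply/eqP; rewrite -measure_le0 (le_trans (measureU2 _ mN mM))//.
  by rewrite [X in (X + _)%E]N0 [X in (_ + X)%E]M0 adde0.
move=> x /= nQ; apply: contrapT => /not_orP[nN nM]; apply: nQ.
by apply: PQ; apply: contrapT => h; [apply: nN; exact: PN|apply: nM; exact: PM].
Qed.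

Lemma ae_neq (c : R) : {ae mu, forall s : R, s != c}.
Proof.
exists [set c]; split; [exact: measurable_set1|exact: lebesgue_measure_set1|].
by move=> s /= /negP; rewrite negbK => /eqP.
Qed.

Lemma ae_primitive G : mu.-integrable [set: R] (EFin \o G) ->
  {ae mu, forall t, 0 < t -> derivable (fun y : R => \int[mu]_(s in `[0, y]) G s) t 1 /\
     (fun y : R => \int[mu]_(s in `[0, y]) G s)^`() t = G t}.
Proof.
move=> iG.
have iGy y : mu.-integrable [set` Interval (BLeft 0) (BRight y)] (EFin \o G).
  by apply: integrableS iG => //; exact: measurable_itv.
have := FTC1 iGy (open_integrable_locally openT iG).
by apply: ae_imp => t Ht t0; apply: Ht; rewrite lte_fin.
Qed.

Lemma ae_derive_density x G T : mu.-integrable [set: R] (EFin \o G) ->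
  (forall t, 0 <= t <= T -> x t - x 0 = \int[mu]_(s in `[0, t]) G s) ->
  {ae mu, forall t, 0 < t < T -> x^`() t = G t}.
Proof.
move=> iG xG; have := ae_primitive iG; apply: ae_imp => t Ht /andP[t0 tT].
have := Ht t0; set F := (fun y : R => _) => -[dF <-]; rewrite !derive1E.
have -> : 'D_1 x t = 'D_1 (F + cst (x 0)) t.
  apply: near_eq_derive; near=> s; rewrite fctE /F -xG ?subrK//.
  by apply/andP; split; apply: ltW; near: s; [exact: lt_nbhsr|exact: lt_nbhsl].
by rewrite (deriveD dF (derivable_cst _ _ _)) derive_cst addr0.
Unshelve. all: by end_near. Qed.

End Primitive.

(** * The differential equation almost everywhere, in the scalar case *)

Section CaputoAE.
Variables (R : realType) (al T : R).
Hypotheses (al01 : 0 < al < 1) (T0 : 0 < T).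
Local Notation mu := (@lebesgue_measure R).
Implicit Types (t s : R) (x f G : R -> R).
Local Notation contT f := {within `[0, T], continuous (f : R -> R)}.

Let al0 : 0 < al. Proof. by case/andP: al01. Qed.
Let al1 : 0 < 1 - al. Proof. by case/andP: al01; rewrite subr_gt0. Qed.
Let al2 : 0 < 2 - al. Proof. by rewrite -[2]/(1 + 1) -addrA addr_gt0. Qed.

Definition frD x t : R := Gamma (2 - al) / t `^ (1 - al) *
  ((Gamma (1 - al))^-1 * \int[mu]_(s in `[0, t]) ((t - s) `^ (- al) * derive1 x s)).

(** The derivative of [x] equals [G] only off a null set, but the integral does not see it; hence
    the formula holds at every [t] in []0, T]]. *)
Lemma frD_conv x G t : mu.-integrable [set: R] (EFin \o G) ->
  (forall s, s < 0 -> G s = 0) ->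
  (forall t, 0 <= t <= T -> x t - x 0 = \int[mu]_(s in `[0, t]) G s) ->
  0 < t <= T -> frD x t = Gamma (2 - al) / Gamma (1 - al) / t `^ (1 - al) * rlconv (1 - al) G t.
Proof.
move=> iG G0 xG /andP[t0 tT].
rewrite /frD (_ : \int[mu]_(s in _) _ = rlconv (1 - al) G t).
  by move: (Gamma _) (Gamma _) (_ `^ _) (rlconv _ _ _) => a b c d; ring.
rewrite Rintegral_mkcond; apply: ae_eq_Rintegral.
apply: (ae_imp2 _ (ae_neq 0) (ae_derive_density iG xG)) => s s0 xs _.
rewrite patchE mem_setE in_itv/= /powk subr_gt0.
(* At [s = t] the Caputo kernel is 0 to a nonzero power, thus 0, in agreement with [powk]. *)
have nal : - al != 0 by rewrite oppr_eq0 gt_eqF.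
have -> : 1 - al - 1 = - al by ring.
have [s_lt0|s_gt0|/eqP] := ltgtP s 0; last by rewrite (negbTE s0).
  by rewrite G0// mulr0.
have [st|st|->] := ltgtP s t => /=.
- by rewrite xs// s_gt0 (lt_le_trans st).
- by rewrite mul0r.
- by rewrite subrr powR0// !mul0r.
Qed.

Lemma Rintegral_conv1 G t : (forall s, s < 0 -> G s = 0) -> measurable_fun [set: R] G ->
  \int[mu]_(s in `[0, t]) G s = rlconv 1 G t.
Proof.
move=> G0 mG; rewrite Rintegral_mkcond; apply: ae_eq_Rintegral.
apply: (ae_imp _ (ae_neq t)) => s st _; rewrite patchE mem_setE in_itv/= powk1 subr_gt0.
have [/G0->|s0] := ltP s 0; first by rewrite mulr0.
by rewrite le_eqVlt (negbTE st)/=; case: ltP; rewrite ?mul1r ?mul0r.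
Qed.

(** Here [powk (2 - al) s] is [s ^ (1 - al)]: moving this weight into the function turns [frJ] into
    an ordinary convolution of order [al]. *)
Definition weighted f s : R := if 0 <= s <= T then powk (2 - al) s * f s else 0.

Lemma weighted_lt0 f s : s < 0 -> weighted f s = 0.
Proof. by move=> s0; rewrite /weighted leNgt s0. Qed.

Lemma integrable_weighted f : contT f -> mu.-integrable [set: R] (EFin \o weighted f).
Proof.
move=> cf; have [M fM] := bounded_clampf T0 cf.
have -> : weighted f = (fun s => powk (2 - al) s * f (clamp T s)) \_ `[0, T].
  apply/funext => s; rewrite patchE mem_setE in_itv/= /weighted.
  by case: ifP => // sT; rewrite clamp_id.
(* The second kernel, of order 1 and based at [T + 1], equals 1 on all of [[0, T]], so the
   convolution dominates the weight there. *)
have ii := @powk_conv_integrable R (2 - al) 1 (T + 1) al2 ltr01.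
rewrite -restrict_EFin. apply: (proj1 (@integrable_mkcond _ (measurableTypeR R) R mu _ _ (measurable_itv _))).
apply: (@le_integrable _ (measurableTypeR R) R mu _ (measurable_itv _) _
     (fun s => (M * (powk (2 - al) s * powk 1 (T + 1 - s)))%:E)).
- apply/measurable_EFinP; apply: measurable_funTS; apply: measurable_funM.
    exact: measurable_powk.
  exact: (continuous_measurable_fun (continuous_clampf T0 cf)).
- move=> s; rewrite /= in_itv/= => /andP[s0 sT]; rewrite lee_fin !normrM.
  rewrite powk1 (_ : 0 < T + 1 - s); last by lra.
  by rewrite normr1 mulr1 mulrC ler_wpM2r// (le_trans (fM _))// ler_norm.
- apply: (@integrableS _ _ _ mu setT) => //.
  under eq_fun do rewrite EFinM.
  exact: (integrableZl measurableT _ ii).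
Qed.

Lemma frJ_weighted f t : t <= T -> frJ al f t = (betac al)^-1 * rlconv al (weighted f) t.
Proof.
move=> tT; rewrite (frJ_powk al01); congr (_ * _); apply: eq_Rintegral => s _.
rewrite /weighted; have [s0|s0] := ltP 0 s; last first.
  rewrite [powk (2 - al) s]powk_le0// !mul0r.
  by case: ifP => _; rewrite ?mul0r mulr0.
have [st|ts] := ltP s t; last by rewrite [powk al _]powk_le0 ?subr_le0// mulr0 !mul0r.
by rewrite (ltW s0) (ltW (lt_le_trans st tT)) /=; ring.
Qed.

(** The integral equation reads [I^1 G = betac^-1 I^al H] with [H] the weighted [f]. Applying
    [I^(1-al)] makes the right side a multiple of [I^1 H] and, as the two integrals commute, the
    left side [I^1 (I^(1-al) G)]: two primitives whose integrands must agree almost everywhere. *)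
Lemma density_ae x f (x0 : R) G : contT f ->
  mu.-integrable [set: R] (EFin \o G) -> (forall s, s < 0 -> G s = 0) ->
  (forall t, 0 <= t <= T -> x t - x 0 = \int[mu]_(s in `[0, t]) G s) ->
  (forall t, 0 <= t <= T -> x t = x0 + frJ al f t) ->
  {ae mu, forall t, 0 < t <= T ->
     rlconv (1 - al) G t = Gamma (1 - al) / Gamma (2 - al) * (t `^ (1 - al) * f t)}.
Proof.
move=> cf iG G0 xG xJ; set C := Gamma (1 - al) / Gamma (2 - al).
have iH := integrable_weighted cf; set H := weighted f in iH.
have H0 s : s < 0 -> H s = 0 by exact: weighted_lt0.
have /measurable_EFinP mG := measurable_int mu iG.
have /measurable_EFinP mH := measurable_int mu iH.
have conv_lt0 a h t : (forall s, s < 0 -> h s = 0) -> t <= 0 -> rlconv a h t = 0.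
  move=> h0 t_le0; rewrite (@eq_rlconv _ _ _ (fun=> 0)); last by move=> s st; rewrite h0// (lt_le_trans st).
  by rewrite /rlconv /Rintegral integral0_eq// => s _; rewrite mulr0.
have x00 : x 0 = x0.
  by rewrite xJ ?lexx ?ltW// frJ_weighted ?ltW// conv_lt0// mulr0 addr0.
have E1 t : t <= T -> rlconv 1 G t = (betac al)^-1 * rlconv al H t.
  move=> tT; have [t0|t0] := leP t 0; first by rewrite !conv_lt0// mulr0.
  have t0T : 0 <= t <= T by rewrite tT ltW.
  by rewrite -Rintegral_conv1// -xG// xJ// x00 frJ_weighted// addrC addKr.
have h2 : 1 <= 1 + (1 - al) by rewrite lerDl ltW.
have h2' : 1 <= 1 - al + 1 by rewrite addrC.
have h2'' : 1 <= 1 - al + al by rewrite subrK.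
have iPhi t := (@rlconv_rlconv R 1 (1 - al) G t ltr01 al1 h2 iG G0).1.
have E2 t := (@rlconv_rlconv R 1 (1 - al) G t ltr01 al1 h2 iG G0).2.
have E3 t := (@rlconv_rlconv R (1 - al) 1 G t al1 ltr01 h2' iG G0).2.
have iE4 t := (@rlconv_rlconv R (1 - al) al H t al1 al0 h2'' iH H0).1.
have E4 t := (@rlconv_rlconv R (1 - al) al H t al1 al0 h2'' iH H0).2.
have E5 t : t <= T -> rlconv 1 (rlconv (1 - al) G) t = C * rlconv 1 H t.
  (* Both orders of integration give the same multiple of the convolution of order [2 - al]. *)
  move=> tT; have -> : rlconv 1 (rlconv (1 - al) G) t = rlconv (1 - al) (rlconv 1 G) t.
    by rewrite E2 E3 (betaC 1 (1 - al)) (addrC 1 (1 - al)).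
  rewrite (@eq_rlconv _ _ _ (fun s => (betac al)^-1 * rlconv al H s)); last first.
    by move=> s st; rewrite E1// (le_trans (ltW st)).
  transitivity ((betac al)^-1 * rlconv (1 - al) (rlconv al H) t).
    rewrite /rlconv -measurable_RintegralZl.
      by apply: eq_Rintegral => s _; rewrite mulrCA.
    by have /measurable_EFinP := measurable_int mu (iE4 t).
  rewrite E4 subrK mulrA; congr (_ * _); rewrite /beta subrK Gamma1 divr1 /betac /C.
  have /gt_eqF g1 := Gamma_gt0 al0; have /gt_eqF g2 := Gamma_gt0 al2.
  by move: (Gamma _) (Gamma _) (Gamma _) g1 g2 => a b c g1 g2; field; rewrite g1 g2.
(* The kernel of order 1 based at [T] only cuts the difference of the integrands off at [T]; this
   makes it integrable on the line, as [ae_primitive] demands. *)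
pose K s := powk 1 (T - s) * rlconv (1 - al) G s - C * (powk 1 (T - s) * H s).
have iH1 t : mu.-integrable [set: R] (EFin \o (fun s => powk 1 (t - s) * H s)).
  apply: (@le_integrable _ (measurableTypeR R) R mu setT measurableT _ (EFin \o H)) => //.
    by apply/measurable_EFinP; exact: measurable_powk_conv.
  move=> s _; rewrite /= lee_fin normrM powk1 -[leRHS]mul1r ler_wpM2r//.
  by case: (0 < _)%R; rewrite ?normr1 ?normr0.
have iCH t : mu.-integrable [set: R] (EFin \o (fun s => C * (powk 1 (t - s) * H s))).
  by have := integrableZl measurableT C (iH1 t); apply: eq_integrable.
have iK : mu.-integrable [set: R] (EFin \o K).
  by have := integrableB measurableT (iPhi T) (iCH T); apply: eq_integrable.
have K0 s : s < 0 -> K s = 0.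
  by move=> s0; rewrite /K conv_lt0 ?H0 ?(ltW s0)// !mulr0 subrr.
have /measurable_EFinP mK := measurable_int mu iK.
have intK t : t <= T -> \int[mu]_(s in `[0, t]) K s = 0.
  move=> tT; rewrite Rintegral_conv1// /rlconv.
  transitivity (\int[mu]_s (powk 1 (t - s) * rlconv (1 - al) G s - C * (powk 1 (t - s) * H s))).
    apply: eq_Rintegral => s _; rewrite /K !powk1 !subr_gt0.
    have [st|st] := ltP s t; last by rewrite !mul0r mulr0 subrr.
    by rewrite (lt_le_trans st tT) !mul1r.
  rewrite RintegralB//.
  rewrite -/(rlconv 1 (rlconv (1 - al) G) t) E5//.
  rewrite measurable_RintegralZl; last exact: measurable_powk_conv.
  by rewrite -/(rlconv 1 H t) subrr.
(* The primitive of [K] is known to vanish only up to [T], so its derivative is computed at points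
   [t < T]; the point [T] is a null set. *)
apply: (ae_imp2 _ (ae_neq T) (ae_primitive iK)) => t tT Kt /andP[t0 tleT].
have t_lt : t < T by rewrite lt_neqAle tT.
have [_ /esym] := Kt t0.
have -> : (fun y : R => \int[mu]_(s in `[0, y]) K s)^`() t = 0.
  rewrite derive1E -[RHS](derive_cst (0 : R) t 1); apply: near_eq_derive.
  near=> s; rewrite intK//; apply: ltW; near: s; exact: lt_nbhsl.
rewrite /K powk1 subr_gt0 t_lt !mul1r => /eqP; rewrite subr_eq0 => /eqP ->; congr (_ * _).
rewrite /H /weighted tleT (ltW t0)/= /powk t0; congr (_ `^ _ * _); ring.
Unshelve. all: by end_near. Qed.

Lemma caputo_ae x f (x0 : R) : contT f -> abs_cont T x ->
  (forall t, 0 <= t <= T -> x t = x0 + frJ al f t) ->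
  {ae mu, forall t, 0 < t <= T -> frD x t = f t}.
Proof.
move=> cf acx xJ; have [g ig xg] := abs_cont_density T0 acx.
(* The density lives on the line, whereas the convolution calculus needs it to vanish on the
   negative half-line. *)
pose G := g \_ `[0, +oo[.
have iG : mu.-integrable [set: R] (EFin \o G).
  rewrite /G -restrict_EFin; apply: (proj1 (@integrable_mkcond _ (measurableTypeR R) R mu _ _ (measurable_itv _))).
  by apply: integrableS ig => //; exact: measurable_itv.
have G0 s : s < 0 -> G s = 0.
  by move=> s0; rewrite /G patchE mem_setE in_itv/= andbT leNgt s0.
have xG t : 0 <= t <= T -> x t - x 0 = \int[mu]_(s in `[0, t]) G s.
  move=> tT; rewrite xg//; apply: eq_Rintegral => s; rewrite inE/= in_itv/= => /andP[s0 _].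
  by rewrite /G patchE mem_setE in_itv/= andbT s0.
apply: (ae_imp _ (density_ae cf iG G0 xG xJ)) => t Ht t0T.
rewrite (frD_conv iG G0 xG t0T) Ht//; case/andP: t0T => t0 tT.
have /gt_eqF g1 := Gamma_gt0 al1; have /gt_eqF g2 := Gamma_gt0 al2.
have /gt_eqF p0 : 0 < t `^ (1 - al) by exact: powR_gt0.
by move: (Gamma _) (Gamma _) (_ `^ _) g1 g2 p0 => a b c g1 g2 p0; field; rewrite g1 g2 p0.
Qed.

End CaputoAE.

(** * Termwise fractional integration of power series *)

Section SeriesExchange.
Variable R : realType.
Local Notation mu := (@lebesgue_measure R).
Implicit Types (t s a : R) (u e : nat -> R).

Lemma nneseries_EFin u : cvgn (series u) ->
  (\sum_(0 <= k <oo) (u k)%:E = (limn (series u))%:E)%E.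
Proof.
move=> cu; apply/cvg_lim => //; rewrite (_ : (fun n => _) = EFin \o series u).
  by apply: cvg_EFin => //; exact: nearW.
by apply/funext => n; rewrite sumEFin.
Qed.

Lemma series_le_const_cvg u v (c : R) : (forall k, `|u k| <= c * v k) ->
  cvgn (series v) -> cvgn (series u).
Proof.
move=> uv cv; apply: (@normed_cvg R R^o u).
apply: (series_le_cvg (u_ := fun k => `|u k|) (v_ := fun k => c * v k)) => //.
- by move=> k; rewrite (le_trans _ (uv k)).
- rewrite (_ : series _ = (fun n => c * series v n)).
    by apply: is_cvgM => //; exact: is_cvg_cst.
  by apply/funext => n; rewrite /series /= mulr_sumr.
Qed.

Lemma ler_series_tail u e (l : R) n : (forall k, `|u k| <= e k) -> cvgn (series e) ->
  series u @ \oo --> l -> `|l - series u n| <= limn (series e) - series e n.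
Proof.
move=> ue ce ul.
have h1 : `|series u m - series u n| @[m --> \oo] --> `|l - series u n|.
  by apply: cvg_norm; apply: cvgB; [exact: ul|exact: cvg_cst].
rewrite -(cvg_lim (@Rhausdorff R) h1); apply: limr_le; first by apply/cvg_ex; eexists; exact: h1.
near=> m; have nm : (n <= m)%N by near: m; exists n.
apply: (@le_trans _ _ (series e m - series e n)).
  rewrite /series /= !(big_cat_nat (leq0n n) nm)/= addrAC subrr add0r addrAC subrr add0r.
  by rewrite (le_trans (ler_norm_sum _ _ _))//; apply: ler_sum => k _.
rewrite lerD2r; apply: nondecreasing_cvgn_le => //.
apply/nondecreasing_seqP => k; rewrite /series /= big_nat_recr//= lerDl.
exact: le_trans (ue k).
Unshelve. all: by end_near. Qed.

(* [e k] is the coefficient of [s ^ k]; the limsup makes the sum measurable without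
   knowing where the series converges. *)
Definition powser e n s : R := \sum_(0 <= k < n) e k * powk (k%:R + 1) s.
Definition powsum e s : R := fine (limn_esup (fun n => (powser e n s)%:E)).

Lemma measurable_powser e n : measurable_fun [set: R] (powser e n).
Proof.
by apply: measurable_sum => k; apply: measurable_funM => //; exact: measurable_powk.
Qed.

Lemma measurable_powsum e : measurable_fun [set: R] (powsum e).
Proof.
apply: (measurableT_comp (fine_measurable measurableT)).
apply: (measurable_fun_limn_esup (D := setT)) => n.
by apply/measurable_EFinP; exact: measurable_powser.
Qed.

Lemma powsum_lt0 e s : s < 0 -> powsum e s = 0.
Proof.
move=> s0; rewrite /powsum (_ : (fun n => _) = (fun=> 0%E)).
  by rewrite (cvg_limn_einf_sup (cvg_cst _)).2.
apply/funext => n; rewrite /powser big1// => k _.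
by rewrite powk_le0 ?mulr0// ltW.
Qed.

Lemma powsumE e s : cvgn (fun n => powser e n s) -> (fun n => powser e n s) @ \oo --> powsum e s.
Proof.
move=> h; rewrite /powsum (_ : limn_esup _ = (limn (fun n => powser e n s))%:E)//.
have h2 : (powser e n s)%:E @[n --> \oo] --> (limn (fun n => powser e n s))%:E.
  by apply: cvg_EFin => //; exact: nearW.
by rewrite (cvg_limn_einf_sup h2).2.
Qed.

Lemma powk_powk_integral a t k : 0 < a ->
  (\int[mu]_s (powk a (t - s) * powk (k%:R + 1) s)%:E =
   (powk (a + (k%:R + 1)) t * beta a (k%:R + 1))%:E)%E.
Proof.
move=> a0; have := @powk_conv_shift R a (k%:R + 1) t 0 a0 (ltr_wpDl (ler0n _ _) ltr01).
by rewrite subr0 => <-; apply: eq_integral => s _; rewrite subr0.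
Qed.

Lemma rlconv_powser e a t n : 0 < a ->
  mu.-integrable [set: R] (EFin \o (fun s => powk a (t - s) * powser e n s)) /\
  rlconv a (powser e n) t =
   \sum_(0 <= k < n) e k * (powk (a + (k%:R + 1)) t * beta a (k%:R + 1)).
Proof.
move=> a0; elim: n => [|n [iIH IH]].
  rewrite /powser big_geq// /rlconv.
  have h : (fun s => powk a (t - s) * \sum_(0 <= k < 0) e k * powk (k%:R + 1) s) = (fun=> 0).
    by apply/funext => s; rewrite big_geq// mulr0.
  rewrite [X in EFin \o X]h; split; first exact: integrable0.
  by rewrite (_ : (fun s => _) = (fun=> 0))// /Rintegral integral0.
have ik : mu.-integrable [set: R] (EFin \o (fun s => powk a (t - s) * powk (n%:R + 1) s)).
  apply/integrableP; split.
    by apply/measurable_EFinP; apply: measurable_powk_conv; exact: measurable_powk.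
  under eq_integral do rewrite /= ger0_norm ?mulr_ge0 ?powk_ge0//.
  by rewrite powk_powk_integral// ltry.
have h s : powk a (t - s) * powser e n.+1 s =
    powk a (t - s) * powser e n s + e n * (powk a (t - s) * powk (n%:R + 1) s).
  by rewrite /powser big_nat_recr//= mulrDr; congr (_ + _); ring.
have ike : mu.-integrable [set: R] (fun s => (e n * (powk a (t - s) * powk (n%:R + 1) s))%:E).
  by have := integrableZl measurableT (e n) ik; apply: eq_integrable.
split.
  by have := integrableD measurableT iIH ike; apply: eq_integrable => // s _; rewrite /= h.
rewrite big_nat_recr//= -IH /rlconv; under eq_Rintegral do rewrite h.
rewrite RintegralD// RintegralZl//; congr (_ + _ * _).
by rewrite /Rintegral powk_powk_integral.
Qed.

(** The series of absolute values serves as majorant: by monotone convergence its integral is the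
    sum assumed to converge. It is therefore finite almost everywhere, which also yields convergence
    of the power series itself. *)
Lemma rlconv_powsum e a t : 0 < a ->
  cvgn (series (fun k => `|e k| * (powk (a + (k%:R + 1)) t * beta a (k%:R + 1)))) ->
  mu.-integrable [set: R] (EFin \o (fun s => powk a (t - s) * powsum e s)) /\
  series (fun k => e k * (powk (a + (k%:R + 1)) t * beta a (k%:R + 1))) @ \oo -->
    rlconv a (powsum e) t.
Proof.
move=> a0 cS.
pose d k s := `|e k| * (powk a (t - s) * powk (k%:R + 1) s).
have d0 k s : 0 <= d k s by rewrite !mulr_ge0 ?powk_ge0.
have md k : measurable_fun [set: R] (d k).
  apply: measurable_funM => //; apply: measurable_powk_conv; exact: measurable_powk.
pose g s := (\sum_(0 <= k <oo) (d k s)%:E)%E.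
have mg : measurable_fun [set: R] g.
  by apply: ge0_emeasurable_sum => [k x _ _|k _]; [rewrite lee_fin|exact/measurable_EFinP].
have g0 s : (0 <= g s)%E by apply: nneseries_ge0 => k _ _; rewrite lee_fin.
have ig : mu.-integrable [set: R] g.
  apply/integrableP; split => //.
  under eq_integral do rewrite gee0_abs//.
  rewrite integral_nneseries//; first last.
  - by move=> k s _; rewrite lee_fin.
  - by move=> k; apply/measurable_EFinP; exact: md.
  rewrite (eq_eseriesr (g := fun k => (`|e k| * (powk (a + (k%:R + 1)) t * beta a (k%:R + 1)))%:E)).
    by rewrite nneseries_EFin// ltry.
  move=> k _; under eq_integral do rewrite /d EFinM.
  rewrite ge0_integralZl//.
  - by rewrite powk_powk_integral// -EFinM.
  - by apply/measurable_EFinP; apply: measurable_powk_conv; exact: measurable_powk.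
  - by move=> s _; rewrite lee_fin mulr_ge0 ?powk_ge0.
have mf n : measurable_fun [set: R] (fun s => (powk a (t - s) * powser e n s)%:E).
  by apply/measurable_EFinP; apply: measurable_powk_conv; exact: measurable_powser.
have mF : measurable_fun [set: R] (fun s => (powk a (t - s) * powsum e s)%:E).
  by apply/measurable_EFinP; apply: measurable_powk_conv; exact: measurable_powsum.
have fcvg : {ae mu, forall s, setT s ->
    (powk a (t - s) * powser e n s)%:E @[n --> \oo] --> (powk a (t - s) * powsum e s)%:E}.
  apply: (ae_imp _ (integrable_ae measurableT ig)) => s /(_ I) gs _.
  apply: cvg_EFin; first exact: nearW.
  (* For [s >= t] the kernel kills the possibly divergent series; for [s < t] it is positive and can
     be divided out of the majorant. *)
  have [ts|st] := leP t s.
    rewrite (@powk_le0 _ a (t - s)) ?subr_le0// mul0r.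
    by rewrite (_ : _ \o _ = (fun=> 0)); [exact: cvg_cst|apply/funext => n /=; rewrite mul0r].
  apply: cvgM; first exact: cvg_cst.
  apply: powsumE.
  have cd : cvgn (series (fun k => d k s)).
    by apply: nnseries_is_cvg => //; rewrite -/(g s) -ge0_fin_numE.
  apply: (series_le_const_cvg (c := (powk a (t - s))^-1) _ cd) => k.
  rewrite /d mulrCA mulKf; last by rewrite gt_eqF ?powk_gt0 ?subr_gt0.
  by rewrite normrM (ger0_norm (powk_ge0 _ _)).
have fg : {ae mu, forall s n, setT s -> (`|(powk a (t - s) * powser e n s)%:E| <= g s)%E}.
  apply: aeW => s n _.
  apply: (@le_trans _ _ (\sum_(0 <= k < n) (d k s)%:E)%E); last first.
    by apply: nneseries_lim_ge => k _ _; rewrite lee_fin.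
  rewrite sumEFin abse_EFin lee_fin normrM (ger0_norm (powk_ge0 _ _)) /powser.
  rewrite (le_trans (ler_wpM2l (powk_ge0 _ _) (ler_norm_sum _ _ _)))//.
  rewrite mulr_sumr; apply: ler_sum => k _; rewrite /d normrM (ger0_norm (powk_ge0 _ _)).
  by rewrite mulrCA.
have [iF _ cI] := @dominated_convergence _ (measurableTypeR R) R mu setT measurableT
  _ _ _ mf mF fcvg ig fg.
split => //.
have := fine_cvg _ _; rewrite -/(rlconv a (powsum e) t).
rewrite (_ : series _ = fine \o [sequence (\int[mu]_s (powk a (t - s) * powser e n s)%:E)%E]_n).
  move=> _; apply: fine_cvg; rewrite /rlconv /Rintegral fineK; first exact: cI.
  exact: integral_fune_fin_num iF.
by apply/funext => n; rewrite /series /= -(rlconv_powser e t n a0).2.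
Qed.

End SeriesExchange.

(** * The differential equation at every point, for scalar power series *)

Section CaputoPowerSeries.
Variables (R : realType) (al T : R) (b : nat -> R) (f x : R -> R) (x0 : R).
Hypotheses (al01 : 0 < al < 1) (T0 : 0 < T).
Local Notation mu := (@lebesgue_measure R).
Hypothesis cb : cvgn (series (fun k => `|b k| * T ^+ k)).
Hypothesis fE : forall t : R, 0 <= t <= T -> series (fun k => b k * t ^+ k) @ \oo --> f t.
Hypothesis cf : {within `[0, T], continuous f}.
Hypothesis xJ : forall t : R, 0 <= t <= T -> x t = x0 + frJ al f t.

Let al0 : 0 < al. Proof. by case/andP: al01. Qed.
Let al1 : 0 < 1 - al. Proof. by case/andP: al01; rewrite subr_gt0. Qed.
Let al2 : 0 < 2 - al. Proof. by rewrite -[2]/(1 + 1) -addrA addr_gt0. Qed.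

(** Coefficient of [t ^+ k.+1] in [frJ al f]. *)
Let c k : R := b k * bmom al k.
(** Coefficients of the formal derivative of [frJ al f], which will be the density of [x]. *)
Let e k : R := c k * (k%:R + 1).

Let pser n (t : R) : R := \sum_(0 <= k < n) b k * t ^+ k.

Let cont_pser n : {within `[0, T], continuous (pser n)}.
Proof. by apply: contT_sum => k _; apply: contTZ; exact: contTX. Qed.

Let tail n : R := limn (series (fun k => `|b k| * T ^+ k)) - series (fun k => `|b k| * T ^+ k) n.

Let tail_cvg : tail n @[n --> \oo] --> (0 : R).
Proof.
rewrite -(subrr (limn (series (fun k => `|b k| * T ^+ k)))).
by apply: cvgB; [exact: cvg_cst|exact: cb].
Qed.

Let pser_tail n t : 0 <= t <= T -> `|f t - pser n t| <= tail n.
Proof.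
move=> t0T; apply: ler_series_tail cb (fE t0T) => k; case/andP: t0T => t0 tT.
rewrite normrM ler_wpM2l// ger0_norm ?exprn_ge0//.
by apply: lerXn2r; rewrite ?nnegrE// ltW.
Qed.

(** The partial sums converge to [f] uniformly on [[0, T]], and [frJ] at [t] is bounded by
    [bmom al 0 * t] times the sup norm. *)
Let frJ_series t : 0 <= t <= T -> series (fun k => c k * t ^+ k.+1) @ \oo --> frJ al f t.
Proof.
move=> t0T; have bt : 0 <= bmom al 0 * t ^+ 1.
  by case/andP: t0T => t0 _; rewrite mulr_ge0// ?expr1// ltW// bmom_gt0.
have sE n : series (fun k => c k * t ^+ k.+1) n = frJ al (pser n) t.
  rewrite (frJ_sum al01 T0)//; last by move=> k _; apply: contTZ; exact: contTX.
  rewrite /series /=; apply: eq_bigr => k _.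
  by rewrite (frJZ al01 T0) ?(frJX al01 T0)//; [rewrite /c -mulrA|exact: contTX].
apply/cvgrPdist_le => eps eps0.
have [n0 _ hn] : \forall n \near \oo, tail n * (bmom al 0 * t ^+ 1) <= eps.
  have h : tail n * (bmom al 0 * t ^+ 1) @[n --> \oo] --> (0 : R).
    by rewrite -(mul0r (bmom al 0 * t ^+ 1)); apply: cvgM; [exact: tail_cvg|exact: cvg_cst].
  by move/cvgrPdist_le : h => /(_ _ eps0); apply: filterS => n; rewrite sub0r normrN => /(le_trans (ler_norm _)).
exists n0 => // n /hn {}hn; rewrite /= sE.
have cd : {within `[0, T], continuous (fun s => f s + -1 * pser n s)}.
  by apply: contTD => //; exact: contTZ.
have -> : frJ al f t - frJ al (pser n) t = frJ al (fun s => f s + -1 * pser n s) t.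
  by rewrite (frJD al01 T0)// ?(frJZ al01 T0)// ?mulN1r//; exact: contTZ.
rewrite (le_trans _ hn)// mulrA; apply: (ler_norm_frJ al01 T0) => // s sT.
by rewrite expr0 mulr1 mulN1r; exact: pser_tail.
Qed.

Let bmom_le1 k : bmom al k <= 1.
Proof.
have -> : 1 = bmom al 0.
  rewrite bmomE// add0r Gamma2 mul1r divff// gt_eqF//; exact: Gamma_gt0.
rewrite (le_trans (ler_norm _))//; apply: ler_norm_bavg => //.
  by exists 1 => u _; rewrite expr0 normr1.
by move=> u /andP[u0 u1]; rewrite expr0 normrX exprn_ile1// ger0_norm ltW.
Qed.

Let powkX (a t : R) k : 0 < t -> powk (a + (k%:R + 1)) t = t ^+ k * t `^ a.
Proof.
move=> t0; rewrite /powk t0 -powR_mulrn ?ltW// -powRD ?(gt_eqF t0) ?implybT//.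
by congr (_ `^ _); ring.
Qed.

Let beta1 k : beta 1 (k%:R + 1) = (k%:R + 1)^-1 :> R.
Proof.
have k0 : 0 < k%:R + 1 :> R by rewrite ltr_wpDl.
have := Gamma_gt0 k0; rewrite /beta Gamma1 (addrC 1 (k%:R + 1)) (GammaS k0).
move: (Gamma _) => G G0; field; by rewrite (gt_eqF G0) (gt_eqF k0).
Qed.

Let coef1 k t : 0 < t -> e k * (powk (1 + (k%:R + 1)) t * beta 1 (k%:R + 1)) = c k * t ^+ k.+1.
Proof.
move=> t0; have /gt_eqF k0 : 0 < k%:R + 1 :> R by rewrite ltr_wpDl.
rewrite [powk _ _](powkX 1 k t0) [beta _ _]beta1 (powRr1 (ltW t0)) exprSr /e.
by move: (c k) (t ^+ k) => p q; field; rewrite k0.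
Qed.

Let C : R := Gamma (1 - al) / Gamma (2 - al).

(** The moment in [c k] is, up to constants, the inverse of the Beta factor produced by [I^(1-al)]:
    this cancellation is the differential equation monomial by monomial. *)
Let coef2 k t : 0 < t ->
  e k * (powk (1 - al + (k%:R + 1)) t * beta (1 - al) (k%:R + 1)) = b k * t ^+ k * (t `^ (1 - al) * C).
Proof.
move=> t0; rewrite [powk _ _](powkX (1 - al) k t0) /e /c (bmomE al01) /beta /C.
have k0 : 0 < k%:R + 1 :> R by rewrite ltr_wpDl.
have k2 : 0 < k%:R + 2 - al :> R by rewrite -addrA ltr_wpDl.
have -> : 1 - al + (k%:R + 1) = k%:R + 2 - al by ring.
have -> : k%:R + 2 = (k%:R + 1) + 1 :> R by ring.
rewrite (GammaS k0).
have := Gamma_gt0 k0; have := Gamma_gt0 al2; have : Gamma (k%:R + 1 + 1 - al) != 0.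
  by rewrite gt_eqF// Gamma_gt0// -!addrA ltr_wpDl// addrA.
move: (Gamma _) (Gamma _) (Gamma _) (Gamma _) (_ `^ _) (t ^+ k) => A1 A2 A3 A4 A5 A6 h1 h2 h3.
by field; rewrite h1 (gt_eqF h2) (gt_eqF h3) (gt_eqF k0).
Qed.

Let cvg1 t : 0 < t <= T ->
  cvgn (series (fun k => `|e k| * (powk (1 + (k%:R + 1)) t * beta 1 (k%:R + 1)))).
Proof.
move=> /andP[t0 tT]; apply: (series_le_const_cvg (c := T) _ cb) => k.
have b1 : 0 <= powk (1 + (k%:R + 1)) t * beta 1 (k%:R + 1) :> R.
  by rewrite mulr_ge0 ?powk_ge0// beta1 invr_ge0 addr_ge0.
rewrite normrM normr_id -normrM coef1// normrM [`|c k|]normrM.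
rewrite (ger0_norm (ltW (bmom_gt0 al01 k))) (ger0_norm (exprn_ge0 _ (ltW t0))).
rewrite -mulrA [leRHS]mulrCA -exprS ler_wpM2l// -[leRHS]mul1r.
rewrite ler_pM ?exprn_ge0 ?(ltW t0) ?(ltW (bmom_gt0 al01 k))//.
by apply: lerXn2r; rewrite ?nnegrE ?(ltW t0) ?(ltW T0).
Qed.

Let cvg2 t : 0 < t <= T -> cvgn (series (fun k =>
  `|e k| * (powk (1 - al + (k%:R + 1)) t * beta (1 - al) (k%:R + 1)))).
Proof.
move=> /andP[t0 tT]; apply: (series_le_const_cvg (c := t `^ (1 - al) * C) _ cb) => k.
have C0 : 0 <= t `^ (1 - al) * C.
  by rewrite mulr_ge0 ?powR_ge0// divr_ge0// ltW// Gamma_gt0.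
rewrite normrM normr_id -normrM coef2// 2!normrM mulrC (ger0_norm C0) ler_wpM2l//.
rewrite ler_wpM2l// normrX (ger0_norm (ltW t0)).
by apply: lerXn2r; rewrite ?nnegrE ?(ltW t0) ?(ltW T0).
Qed.

(** Integrating [powsum e] termwise with order 1 identifies it as a density of [x]; with order
    [1 - al] it gives the Caputo integral. Both hold at every point, so no exceptional null set
    arises. *)
Lemma caputo_pseries t : 0 < t <= T -> frD al x t = f t.
Proof.
move=> t0T; have TT : 0 < T <= T by rewrite T0 lexx.
(* The cut-off at [T] provides integrability on the line and is invisible to convolutions evaluated
   at points up to [T]. *)
pose G s := powk 1 (T - s) * powsum e s.
have iG : mu.-integrable [set: R] (EFin \o G) := (rlconv_powsum ltr01 (cvg1 TT)).1.
have G0 s : s < 0 -> G s = 0 by move=> s0; rewrite /G powsum_lt0// mulr0.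
have /measurable_EFinP mG := measurable_int mu iG.
have GE s u : u <= T -> s < u -> G s = powsum e s.
  by move=> uT su; rewrite /G powk1 subr_gt0 (lt_le_trans su uT) mul1r.
have xG u : 0 <= u <= T -> x u - x 0 = \int[mu]_(s in `[0, u]) G s.
  have f0 : frJ al f 0 = 0.
    rewrite (frJ_avg al01 T0 cf) ?mul0r// lexx ltW//.
  move=> /andP[]; rewrite le_eqVlt => /predU1P[<- _|u0 uT].
    by rewrite subrr set_itv1 Rintegral_set1.
  rewrite Rintegral_conv1// (@eq_rlconv _ _ _ (powsum e)); last by move=> s; exact: GE.
  rewrite !xJ ?lexx ?(ltW u0) ?(ltW T0)// f0 addr0 [_ + _ - _]addrAC subrr add0r.
  have u0T : 0 < u <= T by rewrite u0.
  have := (rlconv_powsum ltr01 (cvg1 u0T)).2.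
  under eq_fun do rewrite coef1//.
  have := frJ_series (t := u); rewrite (ltW u0) uT => /(_ isT) h1 h2.
  by rewrite -(cvg_lim (@Rhausdorff R) h1) -(cvg_lim (@Rhausdorff R) h2).
rewrite (frD_conv al01 iG G0 xG t0T).
case/andP: (t0T) => t0 tT.
rewrite (@eq_rlconv _ _ _ (powsum e)); last by move=> s; exact: GE.
have h1 := (rlconv_powsum al1 (cvg2 t0T)).2.
have h2 : series (fun k => e k * (powk (1 - al + (k%:R + 1)) t * beta (1 - al) (k%:R + 1))) @ \oo -->
    f t * (t `^ (1 - al) * C).
  rewrite (_ : series _ = (fun n => series (fun k => b k * t ^+ k) n * (t `^ (1 - al) * C))).
    by apply: cvgM; [apply: fE; rewrite (ltW t0)|exact: cvg_cst].
  by apply/funext => n; rewrite /series /= mulr_suml; apply: eq_bigr => k _; rewrite coef2.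
rewrite -(cvg_lim (@Rhausdorff R) h1) (cvg_lim (@Rhausdorff R) h2) /C.
have /gt_eqF g1 := Gamma_gt0 al1; have /gt_eqF g2 := Gamma_gt0 al2.
have /gt_eqF p0 : 0 < t `^ (1 - al) by exact: powR_gt0.
by move: (Gamma _) (Gamma _) (_ `^ _) g1 g2 p0 => p q r g1 g2 p0; field; rewrite g1 g2 p0.
Qed.

End CaputoPowerSeries.

(** * Limits of complex matrices by real and imaginary parts *)

Section MatrixLimits.
Variable R : realType.
Local Notation C := R[i].

(** A boolean selects the part, so that the coordinates of [C^d] are indexed by the finite type
    ['I_d * bool]. *)
Definition cpart (b : bool) (z : C) : R := if b then complex.Im z else complex.Re z.

Lemma cpart_ext (z w : C) : (forall b, cpart b z = cpart b w) -> z = w.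
Proof.
move=> h; apply/eqP; have := h true; have := h false.
by rewrite /cpart eq_complex => -> ->; rewrite !eqxx.
Qed.

Lemma cpartD b (z w : C) : cpart b (z + w) = cpart b z + cpart b w.
Proof. by case: b; case: z; case: w. Qed.

Lemma cpartN b (z : C) : cpart b (- z) = - cpart b z.
Proof. by case: b; case: z. Qed.

Lemma cpart_sum b (I : Type) (r : seq I) (P : pred I) (F : I -> C) :
  cpart b (\sum_(i <- r | P i) F i) = \sum_(i <- r | P i) cpart b (F i).
Proof. by apply: (big_morph _ (cpartD b)); case: b. Qed.

Lemma cpartZ b r (z : C) : cpart b (r%:C%C * z) = r * cpart b z.
Proof. by case: b; case: z => u v /=; rewrite mul0r ?subr0 ?addr0. Qed.

Lemma cpart_le_norm b (z : C) : `|cpart b z| <= complex.Re `|z|.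
Proof.
rewrite normc_def /= -sqrtr_sqr ler_sqrt ?addr_ge0 ?sqr_ge0//.
by case: b; rewrite /= ?lerDl ?lerDr sqr_ge0.
Qed.

Lemma Re_norm_le (z : C) : complex.Re `|z| <= `|cpart false z| + `|cpart true z|.
Proof.
rewrite normc_def /= -[leRHS]ger0_norm ?addr_ge0// -sqrtr_sqr ler_sqrt ?sqr_ge0//.
rewrite sqrrD !real_normK ?num_real//.
by rewrite addrAC lerDl mulrn_wge0// mulr_ge0.
Qed.

Lemma normc_lt (z : C) e : (`|z| < e%:C%C) = (complex.Re `|z| < e).
Proof. by rewrite ltcE normc_def /= eqxx. Qed.

Lemma pos_complex (e : C) : 0 < e -> e = (complex.Re e)%:C%C /\ 0 < complex.Re e.
Proof. by case: e => a b; rewrite ltcE /= => /andP[/eqP->]. Qed.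

Lemma mx_cvgP (X : Type) (F : set_system X) (FF : Filter F) m n
    (f : X -> 'M[C]_(m, n)) (l : 'M[C]_(m, n)) :
  f @ F --> l <-> forall i j b, cpart b (f x i j) @[x --> F] --> cpart b (l i j).
Proof.
split => [/cvg_ballP h i j b|h].
  apply/cvgrPdist_lt => e e0.
  have e0' : 0 < e%:C%C :> C by rewrite ltcR.
  apply: filterS (h _ e0') => x [_ /(_ i j)] hb.
  have {}hb : `|l i j - f x i j| < e%:C%C := hb.
  rewrite -cpartN -cpartD; apply: le_lt_trans (cpart_le_norm b _) _.
  by rewrite -normc_lt.
(* Radii of balls are themselves complex, and a positive one is real. Half of it is granted to each
   of the two parts. *)
apply/cvg_ballP => e e0; have [-> r0] := pos_complex e0.
set r := complex.Re e in r0 *.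
have h2 : \forall x \near F, forall i j b, `|cpart b (l i j) - cpart b (f x i j)| < r / 2.
  suff : \forall x \near F, forall p : 'I_m * 'I_n * bool,
      `|cpart p.2 (l p.1.1 p.1.2) - cpart p.2 (f x p.1.1 p.1.2)| < r / 2.
    by apply: filterS => x hx i j b; exact: hx (i, j, b).
  apply: filter_forall => -[[i j] b] /=.
  by move/cvgrPdist_lt : (h i j b); apply; rewrite divr_gt0.
apply: filterS h2 => x hx; split; first by rewrite ltcR.
move=> i j; rewrite /ball/=.
have -> : `|l i j - f x i j| < r%:C%C; last by [].
rewrite normc_lt; apply: le_lt_trans (Re_norm_le _) _.
by rewrite !cpartD !cpartN [ltRHS]splitr ltrD.
Qed.

Lemma mx_cvgn m n (f : nat -> 'M[C]_(m, n)) :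
  (forall i j b, cvgn (fun k => cpart b (f k i j))) -> cvgn f.
Proof.
move=> h; pose l b i j := limn (fun k => cpart b (f k i j)).
apply/cvg_ex; exists (\matrix_(i, j) (l false i j +i* l true i j)%C).
by apply/mx_cvgP => i j [|]; rewrite !mxE /=; exact: h.
Qed.

End MatrixLimits.

(** * Real coordinates of complex vectors *)

Section Coordinates.
Variables (R : realType) (d : nat).
Local Notation C := R[i].
Local Notation mu := (@lebesgue_measure R).
Implicit Types (v w : 'cV[C]_d) (A : 'M[C]_d) (p q : 'I_d * bool) (y : R -> 'cV[C]_d).

(** All operators of the statement act on real and imaginary parts with real kernels, so they
    commute with these coordinates and the scalar results apply to each. *)
Definition co p v : R := cpart p.2 (v p.1 ord0).

Lemma co_ext v w : (forall p, co p v = co p w) -> v = w.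
Proof.
move=> h; apply/matrixP => i j; rewrite ord1; apply: cpart_ext => b.
exact: (h (i, b)).
Qed.

Lemma coD p v w : co p (v + w) = co p v + co p w.
Proof. by rewrite /co mxE cpartD. Qed.

Lemma coN p v : co p (- v) = - co p v.
Proof. by rewrite /co mxE cpartN. Qed.

Lemma co_sum p (I : Type) (r : seq I) (P : pred I) (F : I -> 'cV[C]_d) :
  co p (\sum_(i <- r | P i) F i) = \sum_(i <- r | P i) co p (F i).
Proof. by rewrite /co summxE cpart_sum. Qed.

Lemma coZ p r v : co p (r%:C%C *: v) = r * co p v.
Proof. by rewrite /co mxE cpartZ. Qed.

(* The real matrix of multiplication by [A] when [C^d] is identified with
   [R^('I_d * bool)] through [co]. *)
Definition cm A p q : R := let z := A p.1 q.1 in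
  if p.2 == q.2 then complex.Re z else if p.2 then complex.Im z else - complex.Im z.

Lemma coM p A v : co p (A *m v) = \sum_q cm A p q * co q v.
Proof.
case: p => i b; rewrite /co mxE cpart_sum.
rewrite -(pair_bigA _ (fun j c => cm A (i, b) (j, c) * cpart c (v j ord0))) /=.
apply: eq_bigr => j _; rewrite big_bool /cm /=.
by case: b => /=; case: (A i j) => ? ?; case: (v j ord0) => ? ? /=; ring.
Qed.

Lemma vnorm_ge0 v : 0 <= vnorm v.
Proof. by apply: sumr_ge0 => i _; exact: le_trans (cpart_le_norm false _). Qed.

Lemma vnorm_le_co v : vnorm v <= \sum_p `|co p v|.
Proof.
rewrite -(pair_bigA _ (fun i b => `|cpart b (v i ord0)|)) /= /vnorm.
apply: ler_sum => i _; rewrite big_bool /= addrC; exact: Re_norm_le.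
Qed.

Lemma co_le_vnorm p v : `|co p v| <= vnorm v.
Proof.
apply: le_trans (cpart_le_norm _ _) _; rewrite /vnorm (bigD1 p.1)//= lerDl.
by apply: sumr_ge0 => i _; exact: le_trans (cpart_le_norm false _).
Qed.

Lemma co_vint p (D : set R) y : co p (vint D y) = \int[mu]_(s in D) co p (y s).
Proof. by rewrite /co /vint mxE /cint; case: p => i [|]. Qed.

Lemma co_LJ al p y t : co p (LJ al y t) = frJ al (fun s => co p (y s)) t.
Proof.
rewrite /LJ coZ co_vint /frJ; congr (_ * _).
by apply: eq_Rintegral => s _; rewrite coZ.
Qed.

Lemma co_betaE al p y : co p (betaE al y) = frE al (fun s => co p (y s)).
Proof.
rewrite /betaE coZ co_vint /frE; congr (_ * _).
by apply: eq_Rintegral => s _; rewrite coZ.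
Qed.

Lemma co_LD al p y t : co p (LD al y t) = frD al (fun s => co p (y s)) t.
Proof.
rewrite /LD coZ /CD coZ co_vint /frD; congr (_ * (_ * _)).
apply: eq_Rintegral => s _; rewrite coZ; congr (_ * _).
by rewrite /co /vderiv mxE; case: p => i [|].
Qed.

Lemma co_cvgP (X : Type) (F : set_system X) (FF : Filter F) (f : X -> 'cV[C]_d) v :
  f @ F --> v <-> forall p, co p (f x) @[x --> F] --> co p v.
Proof.
split => [/mx_cvgP h [i b]|h]; first exact: h.
by apply/mx_cvgP => i j b; rewrite ord1; exact: (h (i, b)).
Qed.

(** The source is arbitrary so that it can be [[0, T]] with its subspace topology. *)
Lemma co_continuousP (U : topologicalType) (f : U -> 'cV[C]_d) :
  continuous f <-> forall p, continuous (fun x => co p (f x)).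
Proof.
split => [h p x|h x]; first by have /co_cvgP := h x; exact.
by apply/co_cvgP => p; exact: h.
Qed.

End Coordinates.

(** * Convergence of the Mittag-Leffler series and matrix bounds *)

Section MittagLefflerSeries.
Variables (R : realType) (al : R).
Hypothesis al01 : 0 < al < 1.

(** Ratio test: consecutive terms have ratio [bmom al k * r], which tends to 0. *)
Lemma is_cvg_ml_series r : 0 <= r -> cvgn (series (fun k => ml_coef al k * r ^+ k)).
Proof.
move=> r0; pose v k := ml_coef al k * r ^+ k.
have v0 k : 0 <= v k by rewrite mulr_ge0 ?exprn_ge0// ltW// ml_coef_gt0.
have vS k : v k.+1 = bmom al k * r * v k by rewrite /v ml_coefS// exprS; ring.
have [N _ hN] : \forall k \near \oo, bmom al k * r <= 2^-1.
  have h : bmom al k * r @[k --> \oo] --> (0 : R).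
    by rewrite -(mul0r r); apply: cvgM; [exact: bmom_cvg0|exact: cvg_cst].
  move/cvgrPdist_le : h => /(_ 2^-1); rewrite invr_gt0 ltr0n => /(_ isT).
  by apply: filterS => k; rewrite sub0r normrN => /(le_trans (ler_norm _)).
(* Chosen so that each of the first [N + 1] terms is below [c * 2^-1 ^+ j]; from [N] on the ratio is
   at most 1/2. *)
pose c := \sum_(j < N.+1) v j * 2 ^+ j.
have vc k : v k <= c * 2^-1 ^+ k.
  have small j : (j <= N)%N -> v j <= c * 2^-1 ^+ j.
    move=> jN; rewrite -[leLHS](mulfK (_ : 2 ^+ j != 0)) ?expf_neq0//.
    rewrite exprVn ler_wpM2r ?invr_ge0 ?exprn_ge0//.
    rewrite /c (bigD1 (Ordinal (jN : j < N.+1)%N))//= lerDl sumr_ge0// => i _.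
    by rewrite mulr_ge0 ?exprn_ge0.
  elim: k => [|k IH]; first exact: small.
  case: (leqP k.+1 N) => kN; first exact: small.
  rewrite vS exprS [leRHS]mulrCA; apply: ler_pM => //; last exact: hN.
  by rewrite mulr_ge0// ltW// bmom_gt0.
apply: (series_le_const_cvg (c := c) (v := fun k => 2^-1 ^+ k)) => [k|].
  by rewrite ger0_norm; [exact: vc|exact: v0].
rewrite (_ : (fun k => _) = geometric (1 : R) 2^-1); last first.
  by apply/funext => k; rewrite /= mul1r.
by apply: is_cvg_geometric_series; rewrite ger0_norm ?invr_ge0// invf_lt1// ltr1n.
Qed.

End MittagLefflerSeries.

Section MatrixBound.
Variables (R : realType) (d : nat) (A : 'M[R[i]]_d).
Implicit Types (v : 'cV[R[i]]_d) (p q : 'I_d * bool).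

(** Dominates every row sum of [cm A], hence bounds the action of [A] in the sup norm of the real
    coordinates. *)
Definition cm_norm : R := \sum_p \sum_q `|cm A p q|.

Lemma cm_norm_ge0 : 0 <= cm_norm.
Proof. by apply: sumr_ge0 => p _; apply: sumr_ge0. Qed.

Lemma co_mulmx_le v B p : (forall q, `|co q v| <= B) -> `|co p (A *m v)| <= cm_norm * B.
Proof.
move=> vB; have B0 : 0 <= B by exact: le_trans (vB p).
rewrite coM (le_trans (ler_norm_sum _ _ _))//.
apply: (@le_trans _ _ (\sum_q `|cm A p q| * B)).
  by apply: ler_sum => q _; rewrite normrM ler_wpM2l.
rewrite -mulr_suml ler_wpM2r// /cm_norm [leRHS](bigD1 p)//= lerDl.
by apply: sumr_ge0 => q _; apply: sumr_ge0.
Qed.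

Lemma co_expmx_le k v B p : (forall q, `|co q v| <= B) ->
  `|co p (A ^+ k *m v)| <= cm_norm ^+ k * B.
Proof.
move=> vB; elim: k p => [|k IH] p; first by rewrite !expr0 mul1mx mul1r.
by rewrite !exprS -mulmxE -mulmxA -mulrA; exact: co_mulmx_le.
Qed.

Lemma cpart_expmx_le k i j b : `|cpart b ((A ^+ k) i j)| <= cm_norm ^+ k.
Proof.
have -> : cpart b ((A ^+ k) i j) = co (i, b) (A ^+ k *m delta_mx j ord0).
  by rewrite /co -colE mxE.
rewrite -[leRHS]mulr1; apply: co_expmx_le => -[l c]; rewrite /co mxE eqxx andbT /=.
by case: c; case: (l == j); rewrite /= ?normr0 ?normr1.
Qed.

End MatrixBound.

Lemma scaler_realA (R : realType) m n (M : 'M[R[i]]_(m, n)) (a b : R) :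
  a%:C%C *: (b%:C%C *: M) = (a * b)%:C%C *: M.
Proof. by rewrite scalerA -(rmorphM (real_complex R)). Qed.

Lemma exprZmx (R : realType) (d : nat) (A : 'M[R[i]]_d) (t : R) k :
  (t%:C%C *: A) ^+ k = (t ^+ k)%:C%C *: A ^+ k.
Proof.
elim: k => [|k IH]; first by rewrite !expr0 scale1r.
by rewrite !exprS IH -!mulmxE -scalemxAl -scalemxAr scaler_realA.
Qed.

(** * The operator [LJ] on continuous vector functions *)

Section Vectors.
Variables (R : realType) (d : nat) (al T : R).
Hypotheses (al01 : 0 < al < 1) (T0 : 0 < T).
Implicit Types (t s : R) (v : 'cV[R[i]]_d) (y z : R -> 'cV[R[i]]_d) (p : 'I_d * bool) (A : 'M[R[i]]_d).

Definition contV y := forall p, {within `[0, T], continuous (fun t => co p (y t))}.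

Lemma eq_contT (f g : R -> R) : f =1 g ->
  {within `[0, T], continuous g} -> {within `[0, T], continuous f}.
Proof. by move=> /funext ->. Qed.

Lemma contVD y z : contV y -> contV z -> contV (fun t => y t + z t).
Proof. by move=> cy cz p; apply: (eq_contT (fun t => coD p _ _)); exact: contTD. Qed.

Lemma contVN y : contV y -> contV (fun t => - y t).
Proof.
move=> cy p; apply: (eq_contT (g := fun t => -1 * co p (y t))); last exact: contTZ.
by move=> t; rewrite coN mulN1r.
Qed.

Lemma contV_cst v : contV (fun=> v).
Proof. by move=> p; exact: contT_cst. Qed.

Lemma contV_mulmx A y : contV y -> contV (fun t => A *m y t).
Proof.
move=> cy p; apply: (eq_contT (fun t => coM p A _)).
by apply: contT_sum => q _; apply: contTZ.
Qed.

Lemma contVX k v : contV (fun t => (t ^+ k)%:C%C *: v).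
Proof.
move=> p; apply: (eq_contT (g := fun t => co p v * t ^+ k)).
  by move=> t; rewrite coZ mulrC.
by apply: contTZ; exact: contTX.
Qed.

Lemma contV_LJ y : contV y -> contV (LJ al y).
Proof.
by move=> cy p; apply: (eq_contT (fun t => co_LJ al p y t)); exact: (cont_frJ al01 T0).
Qed.

Lemma LJD y z t : contV y -> contV z -> 0 <= t <= T ->
  LJ al (fun s => y s + z s) t = LJ al y t + LJ al z t.
Proof.
move=> cy cz tT; apply: co_ext => p; rewrite coD !co_LJ -(frJD al01 T0)//.
by congr (frJ al _ t); apply/funext => s; rewrite coD.
Qed.

Lemma LJ_mulmx A y t : contV y -> 0 <= t <= T ->
  LJ al (fun s => A *m y s) t = A *m LJ al y t.
Proof.
move=> cy tT; apply: co_ext => p; rewrite coM co_LJ.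
under eq_bigr => q _.
  rewrite co_LJ -(frJZ al01 T0)//; over.
rewrite -(frJ_sum al01 T0)//; last by move=> q _; exact: contTZ.
by congr (frJ al _ t); apply/funext => s; rewrite coM.
Qed.

Lemma LJX k v t : 0 <= t <= T ->
  LJ al (fun s => (s ^+ k)%:C%C *: v) t = (bmom al k * t ^+ k.+1)%:C%C *: v.
Proof.
move=> tT; apply: co_ext => p; rewrite co_LJ coZ -(frJX al01 T0)// mulrC -(frJZ al01 T0)//.
  by congr (frJ al _ t); apply/funext => s; rewrite coZ mulrC.
exact: contTX.
Qed.

Lemma eq_LJ y z t : 0 <= t <= T -> (forall s, 0 <= s <= T -> y s = z s) ->
  LJ al y t = LJ al z t.
Proof.
move=> /andP[t0 tT] yz; apply: co_ext => p; rewrite !co_LJ.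
by apply: eq_frJ => s /andP[s0 st]; rewrite yz// s0 (le_trans st).
Qed.

Lemma contV_bounded y : contV y ->
  exists2 M : R, 0 <= M & forall t p, 0 <= t <= T -> `|co p (y t)| <= M.
Proof.
move=> cy; have cS : {within `[0, T], continuous (fun t => \sum_p `|co p (y t)|)}.
  by apply: contT_sum => p _ x; apply: cvg_norm; exact: cy.
have [M hM] := bounded_clampf T0 cS; exists M; first exact: le_trans (hM 0).
move=> t p tT; have := hM t; rewrite clamp_id//; apply: le_trans.
rewrite (le_trans _ (ler_norm _))// (bigD1 p)//= lerDl.
exact: sumr_ge0.
Qed.

Lemma LJ_le y M k t p : contV y -> 0 <= t <= T ->
  (forall s q, 0 <= s <= T -> `|co q (y s)| <= M * s ^+ k) ->
  `|co p (LJ al y t)| <= M * bmom al k * t ^+ k.+1.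
Proof.
move=> cy tT yM; rewrite co_LJ; apply: (ler_norm_frJ al01 T0) => // s sT.
exact: yM.
Qed.

Lemma contV_iter_LJ y k : contV y -> contV (iter k (LJ al) y).
Proof. by move=> cy; elim: k => //= k IH; exact: contV_LJ. Qed.

Lemma iter_LJ_le y M k t p : contV y ->
  (forall s q, 0 <= s <= T -> `|co q (y s)| <= M) -> 0 <= t <= T ->
  `|co p (iter k (LJ al) y t)| <= M * ml_coef al k * t ^+ k.
Proof.
move=> cy yM; elim: k t p => [|k IH] t p tT.
  by rewrite ml_coef0 expr0 !mulr1; exact: yM.
rewrite ml_coefS// [bmom _ _ * _]mulrC mulrA; apply: LJ_le => //.
exact: contV_iter_LJ.
Qed.

Lemma nestE_iter theta k t : contV theta -> 0 <= t <= T ->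
  (t ^+ k)%:C%C *: nestE al theta k t = iter k (LJ al) theta t.
Proof.
move=> cth; elim: k t => [|k IH] t tT; first by rewrite expr0 scale1r.
apply: co_ext => p; rewrite coZ /= co_betaE co_LJ.
under [fun s => co p ((_)%:C%C *: _)]eq_fun do rewrite coZ.
apply: (frE_frJ al01 T0 (N := fun s => co p (nestE al theta k s))) => //.
  exact: contV_iter_LJ.
by move=> s sT; rewrite -coZ IH.
Qed.

End Vectors.

(** * Picard iteration and uniform convergence *)

Section PicardSeries.
Variables (R : realType) (d : nat) (al T : R).
Hypotheses (al01 : 0 < al < 1) (T0 : 0 < T).
Variables (A : 'M[R[i]]_d) (x0 : 'cV[R[i]]_d) (theta : R -> 'cV[R[i]]_d).
Hypothesis cth : contV T theta.
Implicit Types (t s : R) (p : 'I_d * bool).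

Local Notation x := (sol_formula al A x0 theta).
Local Notation J := (LJ al).

(** The [k]-th iterate of [LJ] on the constant [x0] appears in closed form, which is what makes the
    Mittag-Leffler series visible. *)
Definition picard_term k t : 'cV[R[i]]_d :=
  (ml_coef al k * t ^+ k)%:C%C *: (A ^+ k *m x0) + A ^+ k *m iter k.+1 J theta t.

Definition picard n t : 'cV[R[i]]_d := \sum_(k < n) picard_term k t.

Lemma co_picard p t n : co p (picard n t) = series (fun k => co p (picard_term k t)) n.
Proof. by rewrite /picard co_sum /series /= big_mkord. Qed.

Lemma contV_picard_term k : contV T (picard_term k).
Proof.
apply: contVD; last by apply: contV_mulmx; exact: contV_iter_LJ.
move=> p; apply: (@eq_contT R T _ (fun t => ml_coef al k * co p (A ^+ k *m x0) * t ^+ k)).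
  by move=> t; rewrite coZ; ring.
by apply: contTZ; exact: contTX.
Qed.

Lemma contV_picard n : contV T (picard n).
Proof.
move=> p; apply: (eq_contT (fun t => co_sum p _ _ _)).
by apply: contT_sum => k _; exact: contV_picard_term.
Qed.

Lemma LJ_picard_term k t : 0 <= t <= T ->
  J (picard_term k) t = (ml_coef al k.+1 * t ^+ k.+1)%:C%C *: (A ^+ k *m x0) +
    A ^+ k *m iter k.+2 J theta t.
Proof.
move=> tT; pose v := (ml_coef al k)%:C%C *: (A ^+ k *m x0).
have -> : J (picard_term k) t = J (fun s => (s ^+ k)%:C%C *: v + A ^+ k *m iter k.+1 J theta s) t.
  apply: (eq_LJ _ tT) => s _; rewrite /picard_term /v scaler_realA.
  by congr ((_)%:C%C *: _ + _); rewrite mulrC.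
have ci : contV T (iter k.+1 J theta) by exact: contV_iter_LJ.
have cA : contV T (fun s => A ^+ k *m iter k.+1 J theta s) by exact: contV_mulmx.
have cX : contV T (fun s => (s ^+ k)%:C%C *: v) by exact: contVX.
rewrite (@LJD R d al T al01 T0 _ _ t cX cA tT) (LJX al01 T0 _ _ tT).
rewrite (@LJ_mulmx R d al T al01 T0 _ _ t ci tT).
rewrite /v scaler_realA [iter k.+2 _ _]iterS (ml_coefS al01).
by rewrite [_ * ml_coef al k * _]mulrAC.
Qed.

Lemma picardS n t : 0 <= t <= T ->
  picard n.+1 t = x0 + J (fun s => A *m picard n s + theta s) t.
Proof.
move=> tT; elim: n => [|n IH].
  rewrite /picard big_ord1 /picard_term ml_coef0 !expr0 mul1r scale1r !mul1mx.
  by congr (_ + _); apply: (eq_LJ _ tT) => s _; rewrite big_ord0 mulmx0 add0r.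
have -> : J (fun s => A *m picard n.+1 s + theta s) t =
    J (fun s => (A *m picard n s + theta s) + A *m picard_term n s) t.
  by apply: (eq_LJ _ tT) => s _; rewrite /picard big_ord_recr /= mulmxDr addrAC.
rewrite (LJD al01 T0) //; last 2 first.
- by apply: contVD => //; apply: contV_mulmx; exact: contV_picard.
- by apply: contV_mulmx; exact: contV_picard_term.
rewrite addrA -IH {1}/picard big_ord_recr /=; congr (_ + _).
rewrite (LJ_mulmx al01 T0) //; last exact: contV_picard_term.
rewrite LJ_picard_term//.
by rewrite mulmxDr -scalemxAr !mulmxA mulmxE -!exprS.
Qed.

Lemma picard_term_le : exists2 D : R, 0 <= D & forall k t p, 0 <= t <= T ->
  `|co p (picard_term k t)| <= D * (ml_coef al k * (cm_norm A * T) ^+ k).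
Proof.
have [D1 D10 h1] := contV_bounded T0 (@contV_cst R d T x0).
(* The bound is on [LJ al theta], not on [theta]: the iterate of index [k.+1] is then the [k]-th
   iterate of a bounded function and receives the same coefficient [ml_coef al k] as the first
   summand. *)
have [D2 D20 h2] := contV_bounded T0 (contV_LJ al01 T0 cth).
exists (D1 + D2); first exact: addr_ge0.
move=> k t p tT; case/andP: (tT) => t0 tleT.
have m0 := ltW (ml_coef_gt0 al01 k).
have tk : t ^+ k <= T ^+ k by apply: lerXn2r; rewrite ?nnegrE// ltW.
have TT : 0 <= T <= T by rewrite lexx ltW.
rewrite coD (le_trans (ler_normD _ _))// mulrDl lerD//.
  rewrite coZ normrM ger0_norm ?mulr_ge0 ?exprn_ge0//.
  have -> : D1 * (ml_coef al k * (cm_norm A * T) ^+ k) =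
      ml_coef al k * T ^+ k * (cm_norm A ^+ k * D1) by rewrite exprMn; ring.
  apply: ler_pM => //; [by rewrite mulr_ge0 ?exprn_ge0|by rewrite ler_wpM2l|].
  by apply: co_expmx_le => q; exact: h1 TT.
rewrite [leRHS](_ : _ = cm_norm A ^+ k * (D2 * ml_coef al k * T ^+ k)); last first.
  by rewrite exprMn; ring.
apply: co_expmx_le => q; rewrite iterSr.
apply: (@le_trans _ _ (D2 * ml_coef al k * t ^+ k)).
  by apply: (iter_LJ_le al01 T0) => //; exact: contV_LJ.
by rewrite ler_wpM2l// mulr_ge0.
Qed.

Lemma cvg_ml_partial t : 0 <= t -> cvgn (ml_partial al (t%:C%C *: A)).
Proof.
move=> t0; apply: mx_cvgn => i j b.
have -> : (fun n => cpart b (ml_partial al (t%:C%C *: A) n i j)) =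
    series (fun k => ml_coef al k * t ^+ k * cpart b ((A ^+ k) i j)).
  apply/funext => n; rewrite /ml_partial summxE cpart_sum /series /= big_mkord.
  by apply: eq_bigr => k _; rewrite exprZmx scaler_realA mxE cpartZ.
apply: (series_le_const_cvg (c := 1)); last first.
  by apply: (is_cvg_ml_series al01 (r := t * cm_norm A)); rewrite mulr_ge0 ?cm_norm_ge0.
move=> k; have m0 := ltW (ml_coef_gt0 al01 k).
rewrite mul1r normrM ger0_norm ?mulr_ge0 ?exprn_ge0// exprMn mulrA.
by rewrite ler_wpM2l ?cpart_expmx_le// mulr_ge0 ?exprn_ge0.
Qed.

Lemma picardE n t : 0 <= t <= T ->
  picard n t = ml_partial al (t%:C%C *: A) n *m x0 + sol_partial al A theta t n.
Proof.
move=> tT; rewrite /picard big_split /=; apply: f_equal2.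
  rewrite /ml_partial mulmx_suml; apply: eq_bigr => k _.
  by rewrite exprZmx scaler_realA scalemxAl.
by apply: eq_bigr => k _; rewrite (nestE_iter al01 T0).
Qed.

Lemma is_cvg_picard p t : 0 <= t <= T -> cvgn (fun n => co p (picard n t)).
Proof.
move=> tT; have [D D0 hD] := picard_term_le.
under eq_fun do rewrite co_picard.
apply: (series_le_const_cvg (c := D) (fun k => hD k t p tT)).
by apply: is_cvg_ml_series; rewrite // mulr_ge0 ?cm_norm_ge0 ?ltW.
Qed.

Lemma cvg_ml_partial_mulmx p t : 0 <= t ->
  co p (ml_partial al (t%:C%C *: A) n *m x0) @[n --> \oo] -->
  co p (ml_mx al (t%:C%C *: A) *m x0).
Proof.
move=> /cvg_ml_partial /mx_cvgP h; rewrite coM.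
under eq_fun do rewrite coM.
apply: cvg_big => [|q _]; first exact: add_continuous.
apply: cvgM; last exact: cvg_cst.
rewrite /cm; case: ifP => _; first exact: (h _ _ false).
case: ifP => _; first exact: (h _ _ true).
by apply: cvgN; exact: (h _ _ true).
Qed.

(** Obtained by difference: the Picard sums and the Mittag-Leffler part converge, hence so does the
    remaining summand. *)
Lemma cvg_sol_partial t : 0 <= t <= T -> cvgn (sol_partial al A theta t).
Proof.
move=> tT; apply: mx_cvgn => i j b; rewrite (ord1 j).
have -> : (fun n => cpart b (sol_partial al A theta t n i ord0)) = (fun n =>
    co (i, b) (picard n t) - co (i, b) (ml_partial al (t%:C%C *: A) n *m x0)).
  by apply/funext => n; rewrite picardE// coD addrAC subrr add0r.
apply: is_cvgB; first exact: is_cvg_picard.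
by apply/cvg_ex; eexists; apply: cvg_ml_partial_mulmx; case/andP: tT.
Qed.

Lemma cvg_picard p t : 0 <= t <= T -> co p (picard n t) @[n --> \oo] --> co p (x t).
Proof.
move=> tT; under eq_fun do rewrite picardE// coD.
rewrite coD; apply: cvgD; first by apply: cvg_ml_partial_mulmx; case/andP: tT.
by have /co_cvgP := cvg_sol_partial tT; exact.
Qed.

Lemma picard_tail : exists2 e : nat -> R, e n @[n --> \oo] --> (0 : R) &
  forall n t p, 0 <= t <= T -> `|co p (x t) - co p (picard n t)| <= e n.
Proof.
have [D D0 hD] := picard_term_le.
pose v k := D * (ml_coef al k * (cm_norm A * T) ^+ k).
have cv : cvgn (series v).
  apply: (series_le_const_cvg (c := D)); last first.
    by apply: (is_cvg_ml_series al01 (r := cm_norm A * T)); rewrite mulr_ge0 ?cm_norm_ge0 ?ltW.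
  move=> k; rewrite ger0_norm// mulr_ge0// mulr_ge0//; first exact/ltW/ml_coef_gt0.
  by rewrite exprn_ge0// mulr_ge0 ?cm_norm_ge0 ?ltW.
exists (fun n => limn (series v) - series v n).
  by rewrite -(subrr (limn (series v))); apply: cvgB; [exact: cvg_cst|exact: cv].
move=> n t p tT; rewrite co_picard; apply: ler_series_tail cv _ => [k|]; first exact: hD.
rewrite (_ : series _ = (fun m => co p (picard m t))); first exact: cvg_picard.
by apply/funext => m; rewrite co_picard.
Qed.

End PicardSeries.

Lemma cvg0_norm_le_eq0 (R : realType) (z : R) (e : nat -> R) :
  e n @[n --> \oo] --> (0 : R) -> (forall n, `|z| <= e n) -> z = 0.
Proof.
move=> e0 ze; apply/eqP; rewrite -normr_le0.
have -> : `|z| = limn (fun=> `|z|) by rewrite lim_cst.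
rewrite -(cvg_lim (@Rhausdorff R) e0); apply: ler_lim.
- exact: is_cvg_cst.
- by apply/cvg_ex; exists 0.
- exact: nearW.
Qed.

Lemma dist_third (R : realType) (a a' b b' r eps : R) : r < eps / 3 ->
  `|a - a'| <= r -> `|b - b'| <= r -> `|b' - a'| < eps / 3 -> `|b - a| < eps.
Proof.
rewrite !ltr_norml !ler_norml => ? /andP[? ?] /andP[? ?] /andP[? ?].
by apply/andP; split; lra.
Qed.

(** * Existence and uniqueness for the integral equation *)

Section Solution.
Variables (R : realType) (d : nat) (al T : R).
Hypotheses (al01 : 0 < al < 1) (T0 : 0 < T).
Variables (A : 'M[R[i]]_d) (x0 : 'cV[R[i]]_d) (theta : R -> 'cV[R[i]]_d).
Hypothesis cth : contV T theta.
Implicit Types (t s : R) (p : 'I_d * bool) (y : R -> 'cV[R[i]]_d).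

Local Notation x := (sol_formula al A x0 theta).
Local Notation J := (LJ al).
Local Notation picard := (picard al A x0 theta).

Lemma contV_sol : contV T x.
Proof.
move=> p; apply/subspace_continuousP => t; rewrite /= in_itv/= => tT.
have [e e0 he] := picard_tail al01 T0 A x0 cth.
apply/cvgrPdist_lt => eps eps0; have eps3 : 0 < eps / 3 by rewrite divr_gt0.
have [N _ hN] : \forall n \near \oo, e n < eps / 3.
  move/cvgrPdist_lt : e0 => /(_ _ eps3); apply: filterS => n.
  by rewrite sub0r normrN => /(le_lt_trans (ler_norm _)).
have cP : contV T (picard N) by exact: contV_picard.
move: (cP p) => /subspace_continuousP /(_ t); rewrite /= in_itv/= => /(_ tT) /cvgrPdist_lt /(_ _ eps3).
apply: filter_app; apply: filterS (withinT _ _) => s.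
rewrite /= in_itv/= => sT.
move=> hP.
suff : `|co p (x t) - co p (x s)| < eps by [].
apply: (@dist_third _ _ _ _ _ (e N) eps (hN N (leqnn N)) (he N s p sT) (he N t p tT)).
exact: hP.
Qed.

(** The Picard recursion has an exact form with indices [n.+1] and [n]; replacing both sums by their
    limit costs errors controlled by the uniform tails. *)
Lemma sol_equation t : 0 <= t <= T -> x t = x0 + J (fun s => A *m x s + theta s) t.
Proof.
move=> tT; apply: co_ext => p; apply/subr0_eq.
have [e e0 he] := picard_tail al01 T0 A x0 cth.
(* Factor by which [LJ] after multiplication by [A] enlarges a constant bound: the case [k = 0] of
   [LJ_le]. *)
pose c := cm_norm A * bmom al 0 * t ^+ 1.
apply: (@cvg0_norm_le_eq0 _ _ (fun n => e n.+1 + e n * c)).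
  rewrite -[0 : R]addr0 -{2}(mul0r c); apply: cvgD; first by rewrite cvg_shiftS.
  by apply: cvgM; [exact: e0|exact: cvg_cst].
move=> n; have cp : contV T (picard n) by exact: contV_picard.
have cx := contV_sol.
pose del s := x s - picard n s.
have cd : contV T del by apply: contVD => //; exact: contVN.
have c1 : contV T (fun s => A *m picard n s + theta s).
  by apply: contVD => //; exact: contV_mulmx.
have c2 : contV T (fun s => A *m del s) by exact: contV_mulmx.
have -> : J (fun s => A *m x s + theta s) t =
    J (fun s => A *m picard n s + theta s) t + J (fun s => A *m del s) t.
  rewrite -(LJD al01 T0 c1 c2 tT).
  by apply: (eq_LJ _ tT) => s _; rewrite addrAC -mulmxDr /del [_ + (_ - _)]addrC subrK.
rewrite addrA -(picardS al01 T0 A x0 cth n tT) [co p (picard n.+1 t + _)]coD opprD addrA.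
rewrite (le_trans (ler_normB _ _))// lerD//; first exact: he.
rewrite /c mulrA mulrA [e n * _]mulrC; apply: (LJ_le al01 T0) => //.
move=> s q sT; rewrite expr0 mulr1; apply: co_mulmx_le => r.
by rewrite /del coD coN; exact: he.
Qed.

(** The difference of two solutions is reproduced by [LJ] after [A]. Iterating bounds it by a
    constant times the general term of a convergent Mittag-Leffler series, which tends to 0. *)
Lemma sol_unique y : contV T y ->
  (forall t, 0 <= t <= T -> y t = x0 + J (fun s => A *m y s + theta s) t) ->
  forall t, 0 <= t <= T -> y t = x t.
Proof.
move=> cy yJ; have cx := contV_sol.
pose del s := y s - x s.
have cd : contV T del by apply: contVD => //; exact: contVN.
have c1 : contV T (fun s => A *m x s + theta s).
  by apply: contVD => //; exact: contV_mulmx.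
have c2 : contV T (fun s => A *m del s) by exact: contV_mulmx.
have delJ t : 0 <= t <= T -> del t = J (fun s => A *m del s) t.
  move=> tT; rewrite /del yJ// sol_equation//.
  have -> : J (fun s => A *m y s + theta s) t =
      J (fun s => A *m x s + theta s) t + J (fun s => A *m del s) t.
    rewrite -(LJD al01 T0 c1 c2 tT).
    by apply: (eq_LJ _ tT) => s _; rewrite addrAC -mulmxDr /del [_ + (_ - _)]addrC subrK.
  by rewrite opprD addrACA subrr add0r addrAC subrr add0r.
have [M M0 hM] := contV_bounded T0 cd.
have bound k t p : 0 <= t <= T ->
    `|co p (del t)| <= M * cm_norm A ^+ k * ml_coef al k * t ^+ k.
  elim: k t p => [|k IH] t p tT; first by rewrite ml_coef0 !expr0 !mulr1; exact: hM.
  rewrite delJ//.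
  have -> : M * cm_norm A ^+ k.+1 * ml_coef al k.+1 =
      cm_norm A * (M * cm_norm A ^+ k * ml_coef al k) * bmom al k.
    by rewrite (ml_coefS al01) exprS; ring.
  apply: (LJ_le al01 T0) => //.
  by move=> s q sT; rewrite -mulrA; apply: co_mulmx_le => r; exact: IH.
move=> t tT; apply: co_ext => p; apply/subr0_eq; rewrite -coN -coD.
have t0 : 0 <= t by case/andP: tT.
apply: (@cvg0_norm_le_eq0 _ _ (fun k => M * (ml_coef al k * (cm_norm A * t) ^+ k))).
  rewrite -(mulr0 M); apply: cvgM; first exact: cvg_cst.
  apply: (@cvg_series_cvg_0 R R^o).
  by apply: is_cvg_ml_series; rewrite // mulr_ge0 ?cm_norm_ge0.
move=> k; apply: le_trans (bound k t p tT) _.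
by rewrite exprMn le_eqVlt; apply/orP; left; apply/eqP; ring.
Qed.

End Solution.

Lemma ae_forall_finType (R : realType) (I : finType) (P : I -> R -> Prop) :
  (forall i, {ae @lebesgue_measure R, forall r, P i r}) ->
  {ae @lebesgue_measure R, forall r, forall i, P i r}.
Proof.
move=> aeP; suff H (s : seq I) : {ae @lebesgue_measure R, forall r, forall i, i \in s -> P i r}.
  by apply: ae_imp (H (enum I)) => r h i; apply: h; rewrite mem_enum.
elim: s => [|j s IH]; first by apply: aeW.
apply: ae_imp2 (aeP j) IH => r Pj Ps i; rewrite inE => /predU1P[->//|]; exact: Ps.
Qed.

(** * The differential equation for vector functions *)

Section CaputoVector.
Variables (R : realType) (d : nat) (al T : R).
Hypotheses (al01 : 0 < al < 1) (T0 : 0 < T).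
Variables (x f : R -> 'cV[R[i]]_d) (x0 : 'cV[R[i]]_d).
Hypothesis cf : contV T f.
Hypothesis xJ : forall t : R, 0 <= t <= T -> x t = x0 + LJ al f t.
Implicit Types (t s : R) (p : 'I_d * bool).

Let co_xJ p t : 0 <= t <= T -> co p (x t) = co p x0 + frJ al (fun s => co p (f s)) t.
Proof. by move=> tT; rewrite xJ// coD co_LJ. Qed.

Lemma LD_ae : abs_cont_on 0 T x ->
  {ae @lebesgue_measure R, forall t, 0 < t <= T -> LD al x t = f t}.
Proof.
move=> acx; have acp p : abs_cont T (fun t => co p (x t)).
  apply: abs_cont_ord => e /acx[del del0 H]; exists del => // n s t h1 h2 h3.
  apply: le_lt_trans (H n s t h1 h2 h3); apply: ler_sum => k _.
  by rewrite -coN -coD; exact: co_le_vnorm.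
have := ae_forall_finType (fun p => caputo_ae al01 T0 (@cf p) (acp p) (@co_xJ p)).
by apply: ae_imp => t h tT; apply: co_ext => p; rewrite co_LD; exact: h.
Qed.

Lemma LD_pseries : abs_pseries_on T f -> forall t, 0 < t <= T -> LD al x t = f t.
Proof.
move=> [c [cc fE]] t tT; apply: co_ext => p; rewrite co_LD.
apply: (caputo_pseries (b := fun k => co p (c k)) al01 T0 _ _ (@cf p) (@co_xJ p)) => //.
  apply: (series_le_const_cvg (c := 1) _ cc) => k.
  rewrite mul1r normrM normr_id [`|T ^+ k|]ger0_norm ?exprn_ge0 ?(ltW T0)//.
  by rewrite ler_wpM2r ?co_le_vnorm// exprn_ge0// ltW.
move=> s sT; have /co_cvgP/(_ p) := fE s sT.
rewrite (_ : (fun n => _) = series (fun k => co p (c k) * s ^+ k))//.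
apply/funext => n; rewrite /series /= co_sum; apply: eq_bigr => k _.
by rewrite coZ mulrC.
Qed.

(** At [t = 0] the formula for [LD] divides by [0 ^ (1 - al) = 0] and returns the default value 0,
    so the extension by continuity is expressed as a limit from the right. *)
Lemma LD_right_limit : (forall t, 0 < t <= T -> LD al x t = f t) ->
  LD al x t @[t --> 0^'+] --> f 0.
Proof.
move=> xf; apply/co_cvgP => p.
have /(continuous_within_itvP _ T0)[_ + _] := @cf p.
apply: cvg_trans; apply: near_eq_cvg; near=> t.
rewrite xf//; apply/andP; split; near: t.
  exact: nbhs_right_gt.
exact: nbhs_right_le.
Unshelve. all: by end_near. Qed.

End CaputoVector.

Lemma abs_pseries_mulmxD (R : realType) (d : nat) (T : R) (A : 'M[R[i]]_d)
    (x th : R -> 'cV[R[i]]_d) : 0 <= T ->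
  abs_pseries_on T x -> abs_pseries_on T th -> abs_pseries_on T (fun t => A *m x t + th t).
Proof.
move=> T0 [c [cc cE]] [b [bc bE]]; exists (fun k => A *m c k + b k); split.
(* [vnorm] is at most the sum of the absolute values of the real coordinates, each bounded by
   [cm_norm A * vnorm (c k) + vnorm (b k)]; the constant collects one such factor per coordinate. *)
- pose K : R := \sum_(p : 'I_d * bool) (cm_norm A + 1).
  apply: (series_le_const_cvg (c := K)
    (v := fun k => vnorm (c k) * T ^+ k + vnorm (b k) * T ^+ k)); last first.
    rewrite (_ : series _ = (fun n => series (fun k => vnorm (c k) * T ^+ k) n +
      series (fun k => vnorm (b k) * T ^+ k) n)); first exact: is_cvgD.
    by apply/funext => n; rewrite /series /= big_split.
  move=> k; have a0 := cm_norm_ge0 A.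
  rewrite normrM [`|T ^+ k|]ger0_norm ?exprn_ge0// -mulrDl mulrA ler_wpM2r ?exprn_ge0//.
  rewrite ger0_norm ?vnorm_ge0// (le_trans (vnorm_le_co _))// /K mulr_suml ler_sum// => p _.
  rewrite coD (le_trans (ler_normD _ _))// mulrDl mul1r mulrDr lerD//.
    by rewrite (le_trans (co_mulmx_le A p (fun q => co_le_vnorm q (c k))))// lerDl mulr_ge0 ?vnorm_ge0.
  by rewrite (le_trans (co_le_vnorm _ _))// lerDr vnorm_ge0.
- move=> t tT; apply/co_cvgP => p.
  have /co_cvgP hc := cE t tT; have /co_cvgP hb := bE t tT.
  rewrite coD coM.
  rewrite (_ : (fun n => _) = (fun n => \sum_q cm A p q * co q (series (fun k => (t ^+ k)%:C%C *: c k) n)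
     + co p (series (fun k => (t ^+ k)%:C%C *: b k) n))).
    apply: cvgD; last exact: hb.
    apply: cvg_big => [|q _]; first exact: add_continuous.
    by apply: cvgM; [exact: cvg_cst|exact: hc].
  apply/funext => n; rewrite -coM -coD /series /= mulmx_sumr -big_split /=; congr (co p _).
  by apply: eq_bigr => k _; rewrite scalerDr scalemxAr.
Qed.

Unset Implicit Arguments.
Set Strict Implicit.
Set Printing Implicit Defensive.

Theorem mainTheorem10 (R : realType) (d : nat) (alpha T : R)
    (A : 'M[R[i]]_d) (theta : R -> 'cV[R[i]]_d) (x0 : 'cV[R[i]]_d) :
  0 < alpha < 1 -> 0 < T -> {within `[0, T], continuous theta} ->
  let x := sol_formula alpha A x0 theta in
  [/\ (* the series in the formula converge on [0, T] *)
      (forall t, 0 <= t <= T ->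
         cvgn (ml_partial alpha (t%:C%C *: A)) /\ cvgn (sol_partial alpha A theta t)),
      (* x is a continuous solution of the integral equation on [0, T] *)
      {within `[0, T], continuous x},
      (forall t, 0 <= t <= T -> x t = x0 + LJ alpha (fun s => A *m x s + theta s) t),
      (* and it is the only continuous one *)
      (forall y : R -> 'cV[R[i]]_d, {within `[0, T], continuous y} ->
         (forall t, 0 <= t <= T -> y t = x0 + LJ alpha (fun s => A *m y s + theta s) t) ->
         forall t, 0 <= t <= T -> y t = x t) &
      (* absolutely continuous case: the differential equation holds a.e. on [0, T] *)
      ((abs_cont_on 0 T theta -> abs_cont_on 0 T x ->
         {ae @lebesgue_measure R, forall t, 0 < t <= T ->
            LD alpha x t = A *m x t + theta t}) /\
      (* power series case: it holds at every t in [0, T] (at t = 0 via the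
         continuous extension of ^L D^alpha x) *)
      (abs_pseries_on T theta -> abs_pseries_on T x ->
         (forall t, 0 < t <= T -> LD alpha x t = A *m x t + theta t) /\
         LD alpha x t @[t --> 0^'+] --> A *m x 0 + theta 0))].
Proof.
move=> al01 T0 cth x.
have cthV : contV T theta by move/co_continuousP : cth.
have cx : contV T x by exact: contV_sol.
have cf : contV T (fun s => A *m x s + theta s).
  by apply: contVD => //; exact: contV_mulmx.
have xJ t : 0 <= t <= T -> x t = x0 + LJ alpha (fun s => A *m x s + theta s) t.
  exact: sol_equation.
split.
- move=> t tT; split; last exact: (cvg_sol_partial al01 T0 x0 cthV tT).
  by case/andP: tT => t0 _; exact: (cvg_ml_partial al01 t0).
- by apply/co_continuousP; exact: cx.
- exact: xJ.
- by move=> y /co_continuousP cy yJ t tT; exact: (sol_unique al01 T0 cthV cy yJ tT).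
split => [_ acx|pth px]; first exact: (LD_ae al01 T0 cf xJ acx).
have pf : abs_pseries_on T (fun s => A *m x s + theta s).
  by apply: abs_pseries_mulmxD => //; exact: ltW.
have E := LD_pseries al01 T0 cf xJ pf.
split; [exact: E|exact: (LD_right_limit T0 cf E)].
Qed.
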